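(* Suppose there is an algorithm solving the problem SSR$_L$ in time $T_L(n,\varepsilon)$ on instances of size $n$ with parameter $\varepsilon$. Then the Subset Sum Ratio problem (SSR) can be solved in time $O(n \cdot T_L(k, \varepsilon/3))$ where $k = \mathrm{polylog}(1/\varepsilon)$ (more precisely $k = O(\log^2(1/\varepsilon))$).
   Context: $\Sigma(Z)$ is the sum of the elements of $Z$. $R(X,Y) := \max\{\Sigma(X)/\Sigma(Y), \Sigma(Y)/\Sigma(X)\}$ with the convention $x/0=\infty$ for $x \ge 0$. For finite $J \subset \mathbb{R}_{>0}$: $\mathrm{OPT}(J) := \min\{R(X,Y) \mid X,Y\subseteq J \text{ disjoint}\}$ and $\mathrm{OPT}_L(J) := \min\{R(X,Y) \mid X,Y \subseteq J \text{ disjoint},\ \max(J) \in X \cup Y\}$. SSR: given a set $I \subset \mathbb{R}_{>0}$ of size $n\ge 2$ and $\varepsilon\in(0,1)$, compute disjoint $X,Y\subseteq I$ with $R(X,Y) \le (1+\varepsilon)\mathrm{OPT}(I)$. SSR$_L$: given a set $I \subset \mathbb{R}_{>0}$ of size $n\ge 2$ and $\varepsilon\in(0,1)$, compute disjoint $X,Y\subseteq I$ (not necessarily containing $\max(I)$) with $R(X,Y) \le (1+\varepsilon)\mathrm{OPT}_L(I)$. Input items are given in sorted order; the model is the Real RAM with constant-time arithmetic and floor. *)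

(* Defs.v *)
From HB Require Import structures.
From mathcomp Require Export all_boot all_order all_algebra.
From mathcomp Require Export finmap.
From mathcomp Require Export all_classical all_reals all_analysis.

Set Implicit Arguments.
Unset Strict Implicit.
Unset Printing Implicit Defensive.

Import Order.TTheory GRing.Theory Num.Theory.
Local Open Scope fset_scope.
Local Open Scope ring_scope.

Section SubsetSumRatio.
Variable R : realType.
Implicit Types (J X Y Z : {fset R}).

Definition Sigma Z : R := \sum_(x <- Z) x.

(* Only used with [0 <= x]; in particular [0/0] is infinite. *)
Definition divi (x y : R) : \bar R := if y == 0 then +oo%E else (x / y)%:E.

Definition ratio X Y : \bar R :=
  Order.max (divi (Sigma X) (Sigma Y)) (divi (Sigma Y) (Sigma X)).

(* The default value 0 is harmless for sets of positive reals. *)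
Definition max_of J : R := \big[Num.max/0]_(x <- J) x.

Definition OPT J : \bar R :=
  \big[Order.min/+oo%E]_(X <- fpowerset J)
    \big[Order.min/+oo%E]_(Y <- fpowerset J | [disjoint X & Y]%fset) ratio X Y.

Definition OPTL J : \bar R :=
  \big[Order.min/+oo%E]_(X <- fpowerset J)
    \big[Order.min/+oo%E]_(Y <- fpowerset J |
        [disjoint X & Y]%fset && (max_of J \in X `|` Y)) ratio X Y.

End SubsetSumRatio.

(* Real RAM: directly addressed real registers, an indirectly addressed real
   memory, unit cost per instruction.  Program constants are integers, so that
   no real number can carry hidden advice. *)
Inductive arith := Add | Sub | Mul | Div.

Inductive instr :=
  | IConst of nat & int               (* r_d := z *)
  | IArith of arith & nat & nat & nat (* r_d := r_a op r_b *)
  | IFloor of nat & nat               (* r_d := floor r_a *)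
  | ILoad of nat & nat                (* r_d := M[r_a] *)
  | IStore of nat & nat               (* M[r_a] := r_b *)
  | IJle of nat & nat & nat.          (* if r_a <= r_b then goto l *)

Definition program := seq instr.

Section RealRAM.
Variable R : realType.

Record state := State { pc : nat; reg : nat -> R; mem : nat -> R }.

Definition upd (f : nat -> R) (i : nat) (v : R) : nat -> R :=
  fun j => if j == i then v else f j.

Definition eval_arith (o : arith) (x y : R) : R :=
  match o with
  | Add => x + y
  | Sub => x - y
  | Mul => x * y
  | Div => if y == 0 then 0 else x / y
  end.

(* Addresses are truncated to natural numbers (0 for negative values). *)
Definition exec (i : instr) (s : state) : state :=
  let: State l r m := s in
  match i with
  | IConst d z => State l.+1 (upd r d z%:~R) m
  | IArith o d a b => State l.+1 (upd r d (eval_arith o (r a) (r b))) m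
  | IFloor d a => State l.+1 (upd r d (Num.floor (r a))%:~R) m
  | ILoad d a => State l.+1 (upd r d (m (Num.truncn (r a)))) m
  | IStore a b => State l.+1 r (upd m (Num.truncn (r a)) (r b))
  | IJle a b l' => State (if r a <= r b then l' else l.+1) r m
  end.

Definition halted (p : program) (s : state) : bool := (size p <= pc s)%N.

Definition step (p : program) (s : state) : state :=
  if onth p (pc s) is Some i then exec i s else s.

(* [step] is the identity on halted states, hence [halted p (run p t s)] means
   that [p] started in [s] halts after at most [t] instructions. *)
Definition run (p : program) (t : nat) (s : state) : state := iter t (step p) s.

Definition items (J : {fset R}) : seq R := sort <=%R (enum_fset J).

(* n in register 0, eps in register 1, the items in increasing order in memory
   cells 0, ..., n-1; everything else is 0. *)
Definition init (J : {fset R}) (eps : R) : state :=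
  State 0 (fun i => if i == 0%N then #|` J|%:R else if i == 1%N then eps else 0)
    (fun i => nth 0 (items J) i).

(* The output is written to cells n, ..., 2n-1: cell n+i tells whether the item
   of rank i belongs to X (1), to Y (2) or to neither (3).  As 0 is not a label,
   every label has to be written explicitly. *)
Definition labelled (J : {fset R}) (s : state) : Prop :=
  forall i, (i < #|` J|)%N -> mem s (#|` J| + i)%N \in [:: 1; 2; 3].

Definition output (J : {fset R}) (s : state) (c : nat) : {fset R} :=
  [fset x in J | mem s (#|` J| + index x (items J))%N == c%:R].

Definition solves (opt : {fset R} -> \bar R) (p : program) (T : nat -> R -> R) :
    Prop :=
  forall (J : {fset R}) (eps : R),
    (forall x, x \in J -> 0 < x) -> (2 <= #|` J|)%N -> 0 < eps < 1 ->
  exists t : nat,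
    let s := run p t (init J eps) in
    [/\ t%:R <= T #|` J| eps,
        halted p s,
        labelled J s
      & (ratio (output J s 1) (output J s 2) <= (1 + eps)%:E * opt J)%E].

Definition solves_SSR := solves (@OPT R).
Definition solves_SSRL := solves (@OPTL R).

End RealRAM.

(* Main.v *)
Require Import Defs.
From mathcomp Require Import fintype finset zify ring lra.
Import Order.TTheory GRing.Theory Num.Theory.
Local Open Scope ring_scope.

Set Implicit Arguments.
Unset Strict Implicit.
Unset Printing Implicit Defensive.

(**
Let [a_0 < a_1 < ...] be the sorted items, [2^L > 1/eps], [s = 2L + 10] and
[k = s^2 + 1].  The program calls the given algorithm on every window of [k]
consecutive items ending in some [a_j] and keeps the best answer.

If [a_i < 2 a_(i-s)] for some [i], two of the [2^s] subsets of the items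
[i-s, ..., i-1] have almost equal sums; removing their intersection gives a pair
of ratio at most [1 + eps/4] inside the window of its largest item.  Otherwise
the items at least double every [s] steps, so all items below the window of
[a_j] together are at most [eps/16 a_(j-1)].  If [j] is the largest index of an
optimal pair, the side without [a_j] has sum at least [a_(j-1)] (or else
[{a_j}, {a_(j-1)}] is at least as good), so restricting the pair to the window
costs a factor at most [1 + eps/4].

The running time of the given algorithm is only known for size exactly [k], so
short windows are padded below with [a_0/B, a_0/B^2, ...] for a huge [B]: a
solution one of whose sides consists of pads only has ratio at least [B/2], and
dropping the pads from any other solution changes its ratio negligibly.  As [k]
labels have to be written, every call takes at least [k] steps, which pays for
all the bookkeeping.
*)

Arguments run : simpl never.

(** * Structured programs on the Real RAM *)

(* Conditions are of the form [r_a <= r_b]; [Sim p] runs [p] in a sandbox. *)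
Inductive cmd :=
  | Block of seq instr
  | Seq of cmd & cmd
  | If of nat & nat & cmd & cmd
  | While of nat & nat & cmd
  | Sim of program.

(* Registers of the simulated program are shifted by 32.  Its memory accesses are
   redirected to [N * (x + 1) + j], where registers 2, 3, 4 and 15 hold 0, 1, [N]
   and [j], and register 30 is scratch. *)
Definition sim_address (l a : nat) : seq instr :=
  [:: IFloor 30 (32 + a); IJle 2 30 (l + 3); IConst 30 0;
      IArith Add 30 30 3; IArith Mul 30 30 4; IArith Add 30 30 15].

(* Padded with idle instructions to the common length 7, which makes jump targets
   easy to translate. *)
Definition sim_instr (base sz l : nat) (i : instr) : seq instr :=
  match i with
  | IConst d z => IConst (32 + d) z :: nseq 6 (IConst 30 0)
  | IArith o d a b =>
      IArith o (32 + d) (32 + a) (32 + b) :: nseq 6 (IConst 30 0)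
  | IFloor d a => IFloor (32 + d) (32 + a) :: nseq 6 (IConst 30 0)
  | ILoad d a => rcons (sim_address l a) (ILoad (32 + d) 30)
  | IStore a b => rcons (sim_address l a) (IStore 30 (32 + b))
  | IJle a b t =>
      rcons (nseq 6 (IConst 30 0))
        (IJle (32 + a) (32 + b) (base + 7 * minn t sz))
  end.

Fixpoint sim_code (base sz l : nat) (p : program) : seq instr :=
  if p is i :: p' then sim_instr base sz l i ++ sim_code base sz (l + 7) p'
  else [::].

Fixpoint clen (c : cmd) : nat :=
  match c with
  | Block s => size s
  | Seq c1 c2 => clen c1 + clen c2
  | If _ _ c1 c2 => (clen c2 + 2 + clen c1)%N
  | While _ _ c1 => (clen c1 + 3)%N
  | Sim p => (7 * size p)%N
  end.

(** Jump targets are absolute, so the code depends on the address [l] at which it is placed.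
    [IJle 0 0] compares a register with itself and serves as an unconditional jump. *)
Fixpoint compile (c : cmd) (l : nat) : seq instr :=
  match c with
  | Block s => s
  | Seq c1 c2 => compile c1 l ++ compile c2 (l + clen c1)
  | If a b c1 c2 =>
      IJle a b (l + (clen c2 + 2)) :: compile c2 l.+1 ++
      IJle 0 0 (l + (clen c2 + 2 + clen c1)) :: compile c1 (l + (clen c2 + 2))
  | While a b c1 =>
      [:: IJle a b l.+2, IJle 0 0 (l + (clen c1 + 3)) &
          compile c1 l.+2 ++ [:: IJle 0 0 l]]
  | Sim p => sim_code l (size p) l p
  end.

Lemma size_sim_instr base sz l i : size (sim_instr base sz l i) = 7%N.
Proof. by case: i. Qed.

Lemma size_sim_code base sz p l : size (sim_code base sz l p) = (7 * size p)%N.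
Proof. by elim: p l => //= i p IH l; rewrite size_cat size_sim_instr IH; lia. Qed.

Lemma size_compile c l : size (compile c l) = clen c.
Proof.
elim: c l => //=.
- by move=> c1 IH1 c2 IH2 l; rewrite size_cat IH1 IH2.
- by move=> a b c1 IH1 c2 IH2 l; rewrite size_cat /= IH1 IH2; lia.
- by move=> a b c IH l; rewrite size_cat /= IH; lia.
- by move=> p l; rewrite size_sim_code.
Qed.

Definition code_at (p : program) (l : nat) (c : seq instr) : Prop :=
  forall i, (i < size c)%N -> onth p (l + i) = onth c i.

Lemma code_at_cons p l i c :
  code_at p l (i :: c) -> onth p l = Some i /\ code_at p l.+1 c.
Proof.
move=> H; split; first by have := H 0%N isT; rewrite addn0.
by move=> j jc; rewrite addSnnS (H j.+1).
Qed.

Lemma code_at_cat p l c1 c2 :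
  code_at p l (c1 ++ c2) -> code_at p l c1 /\ code_at p (l + size c1) c2.
Proof.
move=> H; split=> i ic.
  by rewrite H ?size_cat ?onth_cat ?ic //; lia.
rewrite -addnA H ?size_cat ?ltn_add2l // onth_cat ifF; last by lia.
by rewrite addKn.
Qed.

(** * Total correctness with time bounds *)

Section WeakestPrecondition.
Variable R : realType.
Implicit Types (r m : nat -> R) (Q : (nat -> R) -> (nat -> R) -> Prop).

Lemma step_at (p : program) l r m i :
  onth p l = Some i -> step p (State l r m) = exec i (State l r m).
Proof. by rewrite /step /= => ->. Qed.

Lemma runD (p : program) t1 t2 (s : state R) :
  run p (t1 + t2) s = run p t2 (run p t1 s).
Proof. by rewrite /run addnC iterD. Qed.

Lemma runS (p : program) t (s : state R) : run p t.+1 s = run p t (step p s).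
Proof. by rewrite /run iterSr. Qed.

Lemma run1 (p : program) (s : state R) : run p 1 s = step p s.
Proof. by []. Qed.

(* Total correctness with at most [T] steps, wherever the code is placed. *)
Definition wp (c : cmd) (T : nat) Q r m : Prop :=
  exists t r' m', [/\ (t <= T)%N, Q r' m' &
    forall p l, code_at p l (compile c l) ->
      run p t (State l r m) = State (l + clen c) r' m'].

Lemma wp_weaken c T T' Q Q' r m :
  wp c T Q r m -> (T <= T')%N -> (forall r' m', Q r' m' -> Q' r' m') ->
  wp c T' Q' r m.
Proof.
move=> [t [r' [m' [tT Qr H]]]] TT QQ; exists t, r', m'; split=> //.
- exact: leq_trans tT TT.
- exact: QQ.
Qed.

Lemma wp_seq c1 c2 T1 T2 Q r m :
  wp c1 T1 (wp c2 T2 Q) r m -> wp (Seq c1 c2) (T1 + T2) Q r m.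
Proof.
move=> [t1 [r1 [m1 [tT1 [t2 [r2 [m2 [tT2 Qr H2]]]] H1]]]].
exists (t1 + t2)%N, r2, m2; split=> //; first exact: leq_add.
move=> p l /= /code_at_cat[]; rewrite size_compile => a1 a2.
by rewrite runD H1 // H2 // addnA.
Qed.

Definition straight (i : instr) : bool := if i is IJle _ _ _ then false else true.

Definition exec1 (i : instr) (x : (nat -> R) * (nat -> R)) :=
  let s := exec i (State 0 x.1 x.2) in (reg s, mem s).

Fixpoint exec_block (s : seq instr) (x : (nat -> R) * (nat -> R)) :=
  if s is i :: s' then exec_block s' (exec1 i x) else x.

Lemma run_block p l s r m : all straight s -> code_at p l s ->
  run p (size s) (State l r m) =
  State (l + size s) (exec_block s (r, m)).1 (exec_block s (r, m)).2.
Proof.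
elim: s r m l => [|i s IH] r m l /=; first by rewrite /run /= addn0.
move=> /andP[sti sts] /code_at_cons[p0 ps].
rewrite runS (step_at _ _ p0) -addSnnS.
by case: i sti {p0} => //= *; rewrite (IH _ _ _ sts ps).
Qed.

Lemma wp_block s Q r m : all straight s ->
  Q (exec_block s (r, m)).1 (exec_block s (r, m)).2 -> wp (Block s) (size s) Q r m.
Proof.
move=> sts Qr; do 3 eexists; split; [exact: leqnn | exact: Qr |].
by move=> p l; apply: run_block.
Qed.

Lemma wp_if a b c1 c2 T Q r m :
  (if r a <= r b then wp c1 T Q r m else wp c2 T Q r m) ->
  wp (If a b c1 c2) (T + 2) Q r m.
Proof.
case: ifP => rab [t [r' [m' [tT Qr H]]]].
- exists t.+1, r', m'; split=> //; first by lia.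
  move=> p l /= /code_at_cons[pl] /code_at_cat[_]; rewrite size_compile.
  move=> /code_at_cons[_] a1.
  rewrite runS (step_at _ _ pl) /= rab (addnA l (clen c2 + 2)).
  by apply: H; move: a1; rewrite addn2 !addnS !addSn.
- exists (1 + t + 1)%N, r', m'; split=> //; first by lia.
  move=> p l /= /code_at_cons[pl] /code_at_cat[a2]; rewrite size_compile.
  move=> /code_at_cons[pj] _.
  by rewrite !runD !run1 (step_at _ _ pl) /= rab H // (step_at _ _ pj) /= lexx.
Qed.

(** The number [h] of rounds is fixed in advance and [I u] describes the state after [u] of them. A
    round pays two steps for the test and the jump back, and leaving the loop pays two for the
    failed test and the jump out. *)
Lemma wp_while (I : nat -> (nat -> R) -> (nat -> R) -> Prop) h a b c T r m :
  (forall u r m, (u < h)%N -> I u r m -> r a <= r b /\ wp c T (I u.+1) r m) ->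
  (forall r m, I h r m -> r b < r a) ->
  I 0%N r m -> wp (While a b c) (h * (T + 2) + 2) (I h) r m.
Proof.
move=> Hstep Hend.
(* Induction on the number [d] of rounds still to come. *)
suff: forall d u r m, (u + d = h)%N -> I u r m ->
    wp (While a b c) (d * (T + 2) + 2) (I h) r m.
  by move=> H I0; apply: (H h 0%N).
elim=> [|d IH] u {}r {}m uh Iu.
  move: uh; rewrite addn0 => ?; subst u.
  exists 2%N, r, m; split=> // p l /= /code_at_cons[p0 /code_at_cons[p1 _]].
  rewrite runS (step_at _ _ p0) /= leNgt (Hend _ _ Iu) /= /run /=.
  by rewrite (step_at _ _ p1) /= lexx.
have [|rab [t1 [r1 [m1 [tT1 I1 H1]]]]] := Hstep u r m _ Iu; first by lia.
have [|t2 [r2 [m2 [tT2 I2 H2]]]] := IH u.+1 r1 m1 _ I1; first by lia.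
exists (1 + t1 + (1 + t2))%N, r2, m2; split=> //; first by lia.
move=> p l pl; have /= := pl.
move=> /code_at_cons[p0 /code_at_cons[p1 /code_at_cat[a1]]].
rewrite size_compile => /code_at_cons[pj _].
rewrite !runD !run1 (step_at _ _ p0) /= rab H1 //.
by rewrite (step_at _ _ pj) /= lexx H2.
Qed.

Lemma updS (f : nat -> R) i v : upd f i v i = v.
Proof. by rewrite /upd eqxx. Qed.

Lemma updN (f : nat -> R) i v j : j != i -> upd f i v j = f j.
Proof. by rewrite /upd => /negPf->. Qed.

(* Run [j] of the simulated program keeps its cell [x] in cell [phi N j x]: with
   [N = 2n], distinct runs use disjoint memory, all of it beyond the items and
   the output, so that nothing ever has to be erased. *)
Definition phi (N j x : nat) : nat := (N * x.+1 + j)%N.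

(** Division of [phi N j x] by [N] has quotient [x + 1] and remainder [j]. *)
Lemma phi_inj N j x j' x' : (j < N)%N -> (j' < N)%N ->
  phi N j x = phi N j' x' -> j = j' /\ x = x'.
Proof.
move=> jN jN' /(congr1 (edivn^~ N)).
by rewrite /phi ![(N * _)%N]mulnC !edivn_eq // => -[-> ->].
Qed.

(** [Num.truncn] sends negative reals to 0, whereas the floor does not; hence a negative floor is
    replaced by 0, and the jump skips this sixth instruction when the floor is nonnegative. *)
Lemma run_sim_address N j a r m :
  r 2 = 0 -> r 3 = 1 -> r 4 = N%:R -> r 15 = j%:R ->
  exists t r', [/\ (t <= 6)%N,
    r' 30%N = (phi N j (Num.truncn (r (32 + a)%N)))%:R,
    forall d, d != 30%N -> r' d = r d &
    forall p l, code_at p l (sim_address l a) ->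
      run p t (State l r m) = State (l + 6) r' m].
Proof.
move=> r2 r3 r4 r15.
set f := Num.floor (r (32 + a)%N); set f' := if 0 <= f then f else 0.
have f'E : f'%:~R = (Num.truncn (r (32 + a)%N))%:R :> R.
  rewrite truncEfloor /f' -/f.
  by case: (f) => n.
exists (if 0 <= f then 5%N else 6%N).
exists (upd r 30 ((f'%:~R + 1) * N%:R + j%:R)); split.
- by case: ifP.
- by rewrite updS f'E /phi natrD natrM mulrC natr1.
- by move=> d d30; rewrite updN.
have cat3 g v1 v2 v3 v4 : upd (upd (upd (upd g 30 v1) 30 v2) 30 v3) 30 v4 = upd g 30 v4 :> (nat -> R).
  by apply/funext=> d; rewrite /upd; case: eqP.
have cat4 g v1 v2 v3 v4 v5 :
    upd (upd (upd (upd (upd g 30 v1) 30 v2) 30 v3) 30 v4) 30 v5 = upd g 30 v5 :> (nat -> R).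
  by apply/funext=> d; rewrite /upd; case: eqP.
move=> p l /code_at_cons[p0 /code_at_cons[p1 /code_at_cons[p2]]].
move=> /code_at_cons[p3 /code_at_cons[p4 /code_at_cons[p5 _]]].
have p1E : step p (State l.+1 (upd r 30 f%:~R) m) =
    State (if 0 <= f then (l + 3)%N else l.+2) (upd r 30 f%:~R) m.
  by rewrite (step_at _ _ p1) /= /upd /= r2 ler0z.
have -> : (l + 6)%N = l.+1.+1.+1.+1.+1.+1 by lia.
move: p1E; rewrite /f'; case: ifP => f0 p1E.
- rewrite runS (step_at _ _ p0) /= -/f runS p1E addn3.
  rewrite runS (step_at _ _ p3) runS (step_at _ _ p4) runS (step_at _ _ p5) /run /=.
  by rewrite cat3 /upd /= r3 r4 r15.
- rewrite runS (step_at _ _ p0) /= -/f runS p1E.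
  rewrite runS (step_at _ _ p2) runS (step_at _ _ p3) runS (step_at _ _ p4).
  rewrite runS (step_at _ _ p5) /run /=.
  by rewrite cat4 /upd /= r3 r4 r15.
Qed.

Definition sim_rel N j r0 m0 (s : state R) r m :=
  [/\ forall d, r (32 + d)%N = reg s d,
      forall d, (d < 30)%N -> r d = r0 d,
      forall x, m (phi N j x) = mem s x &
      forall y, (forall x, y != phi N j x) -> m y = m0 y].

Lemma code_at_sim p base sz q l i ins :
  code_at p l (sim_code base sz l q) -> onth q i = Some ins ->
  code_at p (l + 7 * i) (sim_instr base sz (l + 7 * i) ins).
Proof.
elim: q l i => [|x q IH] l [|i] //= /code_at_cat[]; rewrite size_sim_instr.
  by move=> H _ [<-]; rewrite muln0 addn0.
by move=> _ H /(IH _ _ H); rewrite mulnS addnA.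
Qed.

Lemma sim_step N j r0 m0 pL (s : state R) r m : (j < N)%N ->
  r0 2 = 0 -> r0 3 = 1 -> r0 4 = N%:R -> r0 15 = j%:R ->
  sim_rel N j r0 m0 s r m ->
  exists t r' m', [/\ (t <= 7)%N, sim_rel N j r0 m0 (step pL s) r' m' &
    forall p l, code_at p l (compile (Sim pL) l) ->
      run p t (State (l + 7 * minn (pc s) (size pL)) r m) =
      State (l + 7 * minn (pc (step pL s)) (size pL)) r' m'].
Proof.
move=> jN r02 r03 r04 r015 [Hr Hlow Hm Hoth].
rewrite /step; case E: (onth pL (pc s)) => [ins|]; last first.
  by exists 0%N, r, m; split.
have pcs : (pc s < size pL)%N by rewrite -onthTE E.
have minS : minn (pc s) (size pL) = pc s by lia.
have minSS : minn (pc s).+1 (size pL) = (pc s).+1 by lia.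
have upd_shift d v : forall d', upd r (32 + d) v (32 + d') = upd (reg s) d v d'.
  by move=> d'; rewrite /upd eqn_add2l Hr.
have upd_low d v : forall d', (d' < 30)%N -> upd r (32 + d) v d' = r0 d'.
  by move=> d' d'30; rewrite /upd ifF ?Hlow //; lia.
(* The six idle instructions of a translated instruction amount to a single write to the scratch
   register. *)
have nops g : foldr (fun _ f => upd f 30 0) g (nseq 6 tt) = upd g 30 0 :> (nat -> R).
  by apply/funext=> d; rewrite /upd /=; case: eqP.
case: s => l0 rs ms in E Hr Hm pcs minS minSS upd_shift *.
rewrite /= in E Hr Hm pcs minS minSS upd_shift *.
have nop_rel rs' r' l1 : (forall d, r' (32 + d)%N = rs' d) ->
    (forall d, (d < 30)%N -> r' d = r0 d) ->
    sim_rel N j r0 m0 (State l1 rs' ms) (upd r' 30 0) m.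
  move=> H1 H2; split=> //= d d30.
  by rewrite updN ?H2 //; lia.
have at_ins p l : code_at p l (compile (Sim pL) l) ->
    code_at p (l + 7 * l0) (sim_instr l (size pL) (l + 7 * l0) ins).
  by move=> /code_at_sim; apply.
have finish s1 r1 m1 : all straight s1 -> size s1 = 7%N ->
    (forall l, sim_instr l (size pL) (l + 7 * l0) ins = s1) ->
    exec_block s1 (r, m) = (r1, m1) ->
    forall p l, code_at p l (compile (Sim pL) l) ->
    run p 7 (State (l + 7 * minn l0 (size pL)) r m) =
    State (l + 7 * minn l0.+1 (size pL)) r1 m1.
  move=> st1 sz1 insE ex p l /at_ins; rewrite minS minSS insE -sz1 => a1.
  by rewrite run_block // ex sz1 mulnS [(7 + _)%N]addnC addnA.
case: ins E at_ins finish => /=.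
- move=> d z E at_ins finish.
  exists 7%N, (upd (upd r (32 + d) z%:~R) 30 0), m; split=> //.
    by apply: nop_rel; [apply: upd_shift | apply: upd_low].
  apply: (finish (IConst (32 + d) z :: nseq 6 (IConst 30 0))) => //=.
  by rewrite /exec1 /=; congr pair; apply: nops.
- move=> o d a b E at_ins finish.
  exists 7%N, (upd (upd r (32 + d) (eval_arith o (rs a) (rs b))) 30 0), m.
  split=> //; first by apply: nop_rel; [apply: upd_shift | apply: upd_low].
  apply: (finish (IArith o (32 + d) (32 + a) (32 + b) ::
            nseq 6 (IConst 30 0))) => //=.
  by rewrite /exec1 /= !Hr; congr pair; apply: nops.
- move=> d a E at_ins finish.
  exists 7%N, (upd (upd r (32 + d) (Num.floor (rs a))%:~R) 30 0), m.
  split=> //; first by apply: nop_rel; [apply: upd_shift | apply: upd_low].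
  apply: (finish (IFloor (32 + d) (32 + a) :: nseq 6 (IConst 30 0))) => //=.
  by rewrite /exec1 /= !Hr; congr pair; apply: nops.
- move=> d a E at_ins _.
  have [t [r1 [t6 r130 r1E H]]] := @run_sim_address N j a r m
    ltac:(by rewrite Hlow) ltac:(by rewrite Hlow) ltac:(by rewrite Hlow)
    ltac:(by rewrite Hlow).
  exists (t + 1)%N, (upd r1 (32 + d) (ms (Num.truncn (rs a)))), m; split.
  + by lia.
  + split=> //= d'.
    * by rewrite /upd eqn_add2l r1E ?Hr //; lia.
    * by move=> d'30; rewrite updN ?r1E ?Hlow //; lia.
  move=> p l /at_ins /(@code_at_cat _ _ (sim_address _ _) [:: _])[/H{}H].
  move=> /code_at_cons[p1 _].
  rewrite minS minSS runD H run1 (step_at _ _ p1) /= r130 natrK Hm Hr.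
  by congr State; lia.
- move=> a b E at_ins _.
  have [t [r1 [t6 r130 r1E H]]] := @run_sim_address N j a r m
    ltac:(by rewrite Hlow) ltac:(by rewrite Hlow) ltac:(by rewrite Hlow)
    ltac:(by rewrite Hlow).
  exists (t + 1)%N, r1, (upd m (phi N j (Num.truncn (rs a))) (rs b)); split.
  + by lia.
  + split=> //=.
    * by move=> d'; rewrite r1E ?Hr //; lia.
    * by move=> d' d'30; rewrite r1E ?Hlow //; lia.
    (* By injectivity of [phi], the store changes the image of exactly one simulated cell. *)
    * move=> x; rewrite /upd -Hm; congr (if _ then _ else _).
      by apply/eqP/eqP => [/(phi_inj jN jN)[]|->].
    * by move=> y Hy; rewrite updN ?Hoth.
  move=> p l /at_ins /(@code_at_cat _ _ (sim_address _ _) [:: _])[/H{}H].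
  move=> /code_at_cons[p1 _].
  rewrite minS minSS runD H run1 (step_at _ _ p1) /= r130 natrK Hr.
  by rewrite r1E ?Hr; [congr State; lia | lia].
- move=> a b l1 E at_ins _.
  exists 7%N, (upd r 30 0), m; split=> //; first by apply: nop_rel.
  move=> p l /at_ins /(@code_at_cat _ _ (nseq 6 _) [:: _])[a6].
  move=> /code_at_cons[p1 _].
  rewrite minS (@runD _ 6 1) (@run_block p _ (nseq 6 (IConst 30 0)) r m isT a6).
  rewrite run1 (step_at _ _ p1) {p1 a6}.
  have -> : exec_block (nseq 6 (IConst 30 0)) (r, m) = (upd r 30 0, m).
    by rewrite /= /exec1 /=; congr pair; apply: nops.
  rewrite /= !updN ?Hr; [|by lia..].
  case: ifP => // _; rewrite minSS; congr State; lia.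
Qed.

Lemma wp_sim N j pL t (s : state R) r m : (j < N)%N ->
  r 2 = 0 -> r 3 = 1 -> r 4 = N%:R -> r 15 = j%:R ->
  pc s = 0%N -> halted pL (run pL t s) ->
  (forall d, r (32 + d)%N = reg s d) -> (forall x, m (phi N j x) = mem s x) ->
  wp (Sim pL) (7 * t) (sim_rel N j r m (run pL t s)) r m.
Proof.
move=> jN r2 r3 r4 r15 pcs halts Hr Hm.
suff [t' [r' [m' [tT rel H]]]] : exists t' r' m', [/\ (t' <= 7 * t)%N,
    sim_rel N j r m (run pL t s) r' m' &
    forall p l, code_at p l (compile (Sim pL) l) ->
      run p t' (State (l + 7 * minn (pc s) (size pL)) r m) =
      State (l + 7 * minn (pc (run pL t s)) (size pL)) r' m'].
  exists t', r', m'; split=> // p l /H; rewrite pcs min0n muln0 addn0 => ->.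
  by rewrite (minn_idPr halts).
elim: t {halts} => [|t [t' [r' [m' [tT rel H]]]]].
  by exists 0%N, r, m; split=> //; split.
have [t1 [r1 [m1 [tT1 rel1 H1]]]] := sim_step pL jN r2 r3 r4 r15 rel.
exists (t' + t1)%N, r1, m1; split=> //; first by lia.
by move=> p l a1; rewrite runD H // H1.
Qed.

(** This rule and the next three leave slack in the time bound, so that budgets can be stated in
    closed form. *)
Lemma wp_seqI c1 c2 T1 T2 T Q1 Q r m :
  wp c1 T1 Q1 r m -> (forall r' m', Q1 r' m' -> wp c2 T2 Q r' m') ->
  (T1 + T2 <= T)%N -> wp (Seq c1 c2) T Q r m.
Proof.
move=> H1 H2 TT; apply: (@wp_weaken _ _ _ Q _ _ _ _ TT) => //.
by apply: wp_seq; apply: (wp_weaken H1).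
Qed.

Lemma wp_blockI s T Q r m : all straight s -> (size s <= T)%N ->
  Q (exec_block s (r, m)).1 (exec_block s (r, m)).2 -> wp (Block s) T Q r m.
Proof. by move=> st sT Qr; apply: (@wp_weaken _ _ _ Q _ _ _ _ sT) => //; apply: wp_block. Qed.

Lemma wp_ifI a b c1 c2 T T' Q r m :
  (r a <= r b -> wp c1 T Q r m) -> (r b < r a -> wp c2 T Q r m) ->
  (T + 2 <= T')%N -> wp (If a b c1 c2) T' Q r m.
Proof.
move=> H1 H2 TT; apply: (@wp_weaken _ _ _ Q _ _ _ _ TT) => //; apply: wp_if.
by case: leP.
Qed.

Lemma wp_whileI (I : nat -> (nat -> R) -> (nat -> R) -> Prop) h a b c T T' Q r m :
  I 0%N r m ->
  (forall u r m, (u < h)%N -> I u r m -> r a <= r b /\ wp c T (I u.+1) r m) ->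
  (forall r m, I h r m -> r b < r a /\ Q r m) ->
  (h * (T + 2) + 2 <= T')%N -> wp (While a b c) T' Q r m.
Proof.
move=> I0 Hs Hend TT.
apply: (wp_weaken (wp_while Hs (fun r m H => proj1 (Hend r m H)) I0)) => //.
by move=> r' m' /Hend[].
Qed.

End WeakestPrecondition.

(** * The program *)

(* Registers: 0 = n, 1 = eps, 2 = 0, 3 = 1, 4 = 2n, 5 = k, 6 = eps/3, 7 = B,
   8 = n - 1, 9 = k - 1; 15 is the current window [j], 16 and 17 are the best ratio
   so far and its window, 19 and 20 the sums of the current answer; 10-14 and 18
   are temporary. *)
Definition sim_cell (d : nat) : seq instr :=
  [:: IArith Add d d 3; IArith Mul d d 4; IArith Add d d 15].

(** The machine has no logarithm: the loop doubles [eps] until it exceeds 1 and counts the doublings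
    [L], from which [k - 1 = (2L + 10)^2] follows. The base is [B = 100 a_1 / (a_0 eps)], and it
    also serves as the initial best ratio. *)
Definition prelude : cmd :=
  Seq (Block [:: IConst 2 0; IConst 3 1; IArith Add 11 1 2; IConst 12 0])
  (Seq (While 11 3 (Block [:: IArith Add 11 11 11; IArith Add 12 12 3]))
  (Seq (Block [:: IArith Add 12 12 12; IConst 13 10; IArith Add 12 12 13;
                 IArith Mul 9 12 12; IArith Add 5 9 3; IArith Add 4 0 0])
  (Seq (Block [:: IConst 13 3; IArith Div 6 1 13; ILoad 13 2; ILoad 14 3;
                 IArith Sub 8 0 3])
  (Seq (Block [:: IConst 7 100; IArith Mul 7 7 14; IArith Mul 13 13 1;
                 IArith Div 7 7 13])
       (Block [:: IConst 15 0; IArith Add 16 7 2; IConst 17 0]))))).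

(** The window is written from its top cell downwards. When the items are exhausted, register 18
    holds the last value written and is divided by [B] once per cell, which produces the pads
    without computing powers. *)
Definition fill : cmd :=
  Seq (Block [:: IConst 10 0])
  (While 10 9
    (Seq (If 10 15 (Block [:: IArith Sub 11 15 10; ILoad 18 11])
                   (Block [:: IArith Div 18 18 7]))
         (Block (IArith Sub 11 9 10 :: sim_cell 11 ++
                 [:: IStore 11 18; IArith Add 10 10 3])))).

(** With [q] a bound on the registers that the simulated program writes, a constant number of
    instructions restores its initial registers. *)
Definition reset (q : nat) : cmd :=
  Block ([seq IConst (32 + d) 0 | d <- iota 0 q] ++
         [:: IArith Add 32 5 2; IArith Add 33 6 2]).

(** The entry at distance [u] (register 10) from the top has rank [k - 1 - u] in its window, and its
    label is in simulated cell [k + (k - 1 - u)]. *)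
Definition load_label : seq instr :=
  IArith Sub 12 9 10 :: IArith Add 12 12 5 :: sim_cell 12 ++ [:: ILoad 13 12].

(* Only the items of [J] are summed up, the pads are dropped. *)
Definition add_up : cmd :=
  Seq (Block [:: IConst 10 0; IConst 19 0; IConst 20 0])
  (While 10 9
    (Seq (If 10 15
            (Seq (Block ([:: IArith Sub 11 15 10; ILoad 18 11] ++ load_label ++
                         [:: IConst 14 2]))
                 (If 13 3 (Block [:: IArith Add 19 19 18])
                    (If 13 14 (Block [:: IArith Add 20 20 18]) (Block [::]))))
            (Block [::]))
         (Block [:: IArith Add 10 10 3]))).

(* Division by 0 gives 0 on the machine, so that an answer with an empty side has
   score 0 < 1 and is discarded. *)
Definition keep_best : cmd :=
  Seq (Block [:: IArith Div 11 19 20; IArith Div 12 20 19])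
  (Seq (If 11 12 (Block [:: IArith Add 11 12 2]) (Block [::]))
       (If 3 11
          (If 11 16 (Block [:: IArith Add 16 11 2; IArith Add 17 15 2])
             (Block [::]))
          (Block [::]))).

(** Label 3 is written everywhere first, because the run on the best window labels only the items in
    that window. *)
Definition write_out : cmd :=
  Seq (Block [:: IConst 13 3; IConst 10 0])
  (Seq (While 10 8
         (Block [:: IArith Add 11 0 10; IStore 11 13; IArith Add 10 10 3]))
  (Seq (Block [:: IConst 10 0; IArith Add 15 17 2])
  (While 10 9
    (Seq (If 10 15
            (Block (load_label ++
               [:: IArith Sub 11 15 10; IArith Add 11 11 0; IStore 11 13]))
            (Block [::]))
         (Block [:: IArith Add 10 10 3]))))).

Definition main_body (pL : program) (q : nat) : cmd :=
  Seq fill (Seq (reset q) (Seq (Sim pL) (Seq add_up (Seq keep_best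
    (Block [:: IArith Add 15 15 3]))))).

Definition SSR_cmd (pL : program) (q : nat) : cmd :=
  Seq prelude (Seq (While 15 8 (main_body pL q)) write_out).

(** * Correctness and running time of the program *)

Section ProgramCorrectness.
Variable R : realType.
Variables (n kk q : nat) (eps B : R) (a : nat -> R) (lab : nat -> nat -> R).
Let k := kk.+1.
Let N := (2 * n)%N.
Hypothesis n_gt0 : (0 < n)%N.
Hypothesis B_neq0 : B != 0.
Hypothesis labP : forall j t, (j < n)%N -> (t < k)%N -> lab j t \in [:: 1; 2; 3].
Implicit Types (r m : nat -> R).

Definition env (d : nat) : R :=
  nth 0 [:: n%:R; eps; 0; 1; N%:R; k%:R; eps / 3; B; n%:R - 1; kk%:R] d.

(** The second clause concerns the simulated registers that [reset] does not clear: they have to be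
    0 before every run. *)
Definition frame r : Prop :=
  (forall d, (d < 10)%N -> r d = env d) /\
  (forall d, (q <= d)%N -> r (32 + d)%N = 0).

Lemma frameE r : frame r ->
  (r 0%N = n%:R) * (r 1%N = eps) * (r 2%N = 0) * (r 3%N = 1) *
  (r 4%N = N%:R) * (r 5%N = k%:R) * (r 6%N = eps / 3) * (r 7%N = B) *
  (r 8%N = n%:R - 1) * (r 9%N = kk%:R).
Proof. by move=> [F _]; do 9?split; rewrite F. Qed.

Lemma frame_upd r i v : (10 <= i < 32)%N -> frame r -> frame (upd r i v).
Proof.
move=> i_bd [F1 F2].
by split=> d H; [rewrite updN ?F1 | rewrite updN ?F2] => //; lia.
Qed.

(** The items preceded by [k - 1] pads. Window [j] consists of the entries [j, ..., j + k - 1], the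
    last of which is [a_j]. *)
Definition padded (u : nat) : R :=
  if (kk <= u)%N then a (u - kk) else a 0%N / B ^+ (kk - u).

Lemma paddedS u : (u < kk)%N -> padded u = padded u.+1 / B.
Proof.
move=> ukk; clear -ukk; rewrite /padded [in LHS]ifF; last by lia.
case: ifP => H.
  have -> : (kk - u = 1)%N by lia.
  by have -> : (u.+1 - kk = 0)%N by lia.
have -> : (kk - u = (kk - u.+1).+1)%N by lia.
by rewrite exprSr invfM mulrA.
Qed.

Lemma phi_ge j x : (N <= phi N j x)%N.
Proof. by rewrite /phi; lia. Qed.

Lemma phiE j x : ((x%:R + 1) * N%:R + j%:R) = (phi N j x)%:R :> R.
Proof. by rewrite /phi natrD natrM mulrC natr1. Qed.

Lemma le_pred j : ((j%:R : R) <= n%:R - 1) = (j < n)%N.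
Proof. by rewrite lerBrDr natr1 ler_nat. Qed.

Definition keeps r r' : Prop :=
  [/\ r' 15%N = r 15%N, r' 16%N = r 16%N & r' 17%N = r 17%N].

Lemma keeps_trans r1 r2 r3 : keeps r1 r2 -> keeps r2 r3 -> keeps r1 r3.
Proof. by rewrite /keeps => -[-> -> ->]. Qed.

Lemma wp_fill j r m : (j < n)%N -> frame r -> r 15%N = j%:R ->
  (forall i, (i < n)%N -> m i = a i) -> (forall x, m (phi N j x) = 0) ->
  wp fill (k * 15 + 3)
    (fun r' m' => [/\ frame r', keeps r r',
      forall x, m' (phi N j x) = if (x < k)%N then padded (j + x) else 0 &
      forall y, (forall x, y != phi N j x) -> m' y = m y]) r m.
Proof.
move=> jn F r15 ma m0.
pose I u r' m' := [/\ frame r', r' 10%N = u%:R, keeps r r',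
  (0 < u)%N -> r' 18%N = padded (j + k - u) &
  (forall x, m' (phi N j x) = if (k - u <= x < k)%N then padded (j + x) else 0)
  /\ (forall y, (forall x, y != phi N j x) -> m' y = m y)].
apply: (@wp_seqI _ _ _ 1 (k * 15 + 2) _ (I 0%N)); last by lia.
  apply: wp_blockI => //; split=> //=; first exact: frame_upd.
  by split=> // x; rewrite subn0 m0; case: ifP => //; lia.
move=> r1 m1 I0; apply: (@wp_whileI _ I k _ _ _ 13 _ _ _ _ I0); last by lia.
- move=> u r2 m2 uk [F2 r10 [k15 k16 k17] r18 [mphi moth]]; split.
    by rewrite r10 (frameE F2) ler_nat; lia.
  pose I' r' m' := [/\ frame r', r' 10%N = u%:R, keeps r r',
    r' 18%N = padded (j + (kk - u)) & m' = m2].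
  apply: (@wp_seqI _ _ _ 4 6 _ I') => //.
    apply: (@wp_ifI _ _ _ _ _ 2) => //.
      rewrite r10 k15 r15 ler_nat => uj.
      apply: wp_blockI => //=; rewrite /exec1 /=; split=> //=.
      - by do 2?apply: frame_upd.
      - rewrite /upd /= k15 r15 r10 -natrB // natrK moth; last first.
          by move=> x; have := phi_ge j x; rewrite /N; lia.
        rewrite ma; last by lia.
        by rewrite /padded ifT; [congr a; lia | lia].
    rewrite r10 k15 r15 ltr_nat => ju.
    apply: wp_blockI => //=; rewrite /exec1 /=; split=> //=.
    - by apply: frame_upd.
    - rewrite /upd /= (frameE F2) (negPf B_neq0) r18; last by lia.
      have -> : (j + k - u = (j + (kk - u)).+1)%N by rewrite /k; lia.
      by rewrite -paddedS //; lia.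
  move=> r3 m3 [F3 r310 [k315 k316 k317] r318 ->].
  apply: wp_blockI => //=; rewrite /exec1 /=; split=> //=.
  - by do 5?apply: frame_upd.
  - by rewrite /upd /= r310 (frameE F3) natr1.
  - by move=> _; rewrite /upd /= r318; congr padded; rewrite /k; lia.
  rewrite /upd /= r310 !(frameE F3) k315 r15 -natrB; last by lia.
  rewrite phiE natrK r318; split.
    move=> x; case: eqP => [/phi_inj[||_ ->] | xE]; try by rewrite /N; lia.
      by rewrite ifT //; rewrite /k; lia.
    rewrite mphi; have xE' : x != (kk - u)%N by apply/eqP => E; apply: xE; rewrite E.
    by congr (if _ then _ else _); rewrite /k; lia.
  by move=> y Hy; rewrite ifF ?moth //; apply/negbTE/Hy.
- move=> r2 m2 [F2 r10 kr r18 [mphi moth]]; split.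
    by rewrite r10 (frameE F2) ltr_nat.
  split=> // x; rewrite mphi subnn //.
Qed.

Lemma exec_block_cat s1 s2 (x : (nat -> R) * (nat -> R)) :
  exec_block (s1 ++ s2) x = exec_block s2 (exec_block s1 x).
Proof. by elim: s1 x => //= i s1 IH x; rewrite IH. Qed.

Lemma exec_zero s r m :
  exec_block [seq IConst (32 + d) 0 | d <- s] (r, m) =
  (fun d => if (32 <= d)%N && ((d - 32)%N \in s) then 0 else r d, m).
Proof.
elim: s r => [|d0 s IH] r.
  by congr pair; apply/funext => d; rewrite andbF.
rewrite [LHS]/= /exec1 IH; congr pair; apply/funext => d.
rewrite in_cons /upd; case: (boolP (32 <= d)%N) => [d32|] //=; last first.
  by move=> d32; rewrite /upd ifF //; lia.
case: (boolP (_ \in s)) => _; rewrite ?orbT ?orbF //.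
by congr (if _ then _ else _); lia.
Qed.

Lemma wp_reset r m : (2 <= q)%N -> frame r ->
  wp (reset q) (q + 2)
    (fun r' m' => [/\ frame r', keeps r r',
      forall d, r' (32 + d)%N =
        if d == 0%N then k%:R else if d == 1%N then eps / 3 else 0 &
      m' = m]) r m.
Proof.
move=> q2 F; apply: wp_blockI.
- by rewrite all_cat all_map /= andbT; apply/allP.
- by rewrite size_cat size_map size_iota.
rewrite exec_block_cat exec_zero /= /exec1 /=.
have rE d v w : v = k%:R -> w = eps / 3 ->
    upd (upd (fun d => if (31 < d)%N && (d - 32 \in iota 0 q)%N then 0
    else r d) 32 v) 33 w (32 + d)%N =
    if d == 0%N then k%:R else if d == 1%N then eps / 3 else 0.
  move=> -> ->; case: d => [|[|d]]; rewrite /upd //=.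
  rewrite mem_iota; case: ifP => // H; apply: (F.2 d.+2).
  by move: H; lia.
have lowE d v w : (d < 32)%N ->
    upd (upd (fun d => if (31 < d)%N && (d - 32 \in iota 0 q)%N then 0
    else r d) 32 v) 33 w d = r d.
  by move=> d32; rewrite !updN; [rewrite ifF //|..]; lia.
split=> //.
- split=> d Hd; first by rewrite lowE ?F.1 //; lia.
  rewrite rE; try by rewrite /upd /= !(frameE F) addr0.
  by case: d Hd => [|[|d]] //; lia.
- by move=> d; rewrite rE // /upd /= !(frameE F) addr0.
Qed.

(** Indexed by the distance [u] below the top of the window, as in the loops of the program;
    distances [u > j] belong to pads and contribute 0. *)
Definition part (c : R) (j u : nat) : R :=
  if (u <= j)%N && (lab j (kk - u) == c) then a (j - u) else 0.

Definition part_sum (c : R) (j : nat) : R := \sum_(u < k) part c j u.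

Lemma exec_load_label j u r m : (u <= kk)%N -> frame r ->
  r 10%N = u%:R -> r 15%N = j%:R ->
  exists v, exec_block load_label (r, m) =
    (upd (upd r 12 v) 13 (m (phi N j (k + (kk - u)))), m).
Proof.
move=> uk F r10 r15; rewrite /load_label /= /exec1 /=.
eexists; congr pair; rewrite {1}/upd /=.
rewrite !/(upd _ _ _ _) /= r10 r15 !(frameE F) -natrB // -natrD phiE natrK.
rewrite [(kk - u + _)%N]addnC.
apply/funext => d; rewrite /upd; case: eqP => // _.
by case: eqP => //.
Qed.

Lemma wp_add_up j r m : (j < n)%N -> frame r -> r 15%N = j%:R ->
  (forall i, (i < n)%N -> m i = a i) ->
  (forall t, (t < k)%N -> m (phi N j (k + t)) = lab j t) ->
  wp add_up (k * 21 + 5)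
    (fun r' m' => [/\ frame r', keeps r r', r' 19%N = part_sum 1 j,
                     r' 20%N = part_sum 2 j & m' = m]) r m.
Proof.
move=> jn F r15 ma ml.
pose I u r' m' := [/\ frame r', r' 10%N = u%:R, keeps r r',
  r' 19%N = \sum_(v < u) part 1 j v /\ r' 20%N = \sum_(v < u) part 2 j v & m' = m].
apply: (@wp_seqI _ _ _ 3 (k * 21 + 2) _ (I 0%N)); last by lia.
  apply: wp_blockI => //; split=> //=; last by rewrite !big_ord0.
  by do 3?apply: frame_upd.
move=> r1 m1 I0; apply: (@wp_whileI _ I k _ _ _ 19 _ _ _ _ I0); last by lia.
- move=> u r2 m2 uk [F2 r10 [k15 k16 k17] [r19 r20] m2E]; split.
    by rewrite r10 (frameE F2) ler_nat; lia.
  subst m2.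
  pose I' r' m' := [/\ frame r', r' 10%N = u%:R, keeps r r',
    r' 19%N = \sum_(v < u.+1) part 1 j v /\ r' 20%N = \sum_(v < u.+1) part 2 j v &
    m' = m].
  apply: (@wp_seqI _ _ _ 18 1 _ I') => //; last first.
    move=> r3 m3 [F3 r310 k3 [r319 r320] ->].
    apply: wp_blockI => //=; rewrite /exec1 /=; split=> //=.
    - by apply: frame_upd.
    - by rewrite /upd /= r310 (frameE F3) natr1.
  rewrite !big_ord_recr /= in I' *.
  apply: (@wp_ifI _ _ _ _ _ 16) => //; rewrite r10 k15 r15 ?ler_nat ?ltr_nat => uj;
    last first.
    by apply: wp_blockI => //=; split=> //; rewrite /part leqNgt uj !addr0.
  pose I2 r' m' := [/\ frame r', r' 10%N = u%:R, keeps r r',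
    [/\ r' 19%N = \sum_(v < u) part 1 j v, r' 20%N = \sum_(v < u) part 2 j v,
        r' 18%N = a (j - u), r' 13%N = lab j (kk - u) & r' 14%N = 2] & m' = m].
  apply: (@wp_seqI _ _ _ 9 6 _ I2) => //.
    apply: wp_blockI => //.
    rewrite -[X in exec_block X]/([:: IArith Sub 11 15 10; ILoad 18 11] ++
                                  load_label ++ [:: IConst 14 2]).
    rewrite !exec_block_cat.
    have -> : exec_block [:: IArith Sub 11 15 10; ILoad 18 11] (r2, m) =
        (upd (upd r2 11 (j - u)%:R) 18 (a (j - u)), m).
      rewrite /= /exec1 /= updS k15 r15 r10 -natrB // natrK ma //; lia.
    set r3 := upd (upd r2 11 _) 18 _.
    have F3 : frame r3 by do 2?apply: frame_upd.
    have uk' : (u <= kk)%N by lia.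
    have [||v ->] := @exec_load_label j u r3 m uk' F3.
    - by rewrite /r3 /upd.
    - by rewrite /r3 /upd /= k15.
    rewrite /= ml; last by lia.
    split=> //=; first by do 3?apply: frame_upd.
  move=> r3 m3 [F3 r310 k3 [r319 r320 r318 r313 r314] ->].
  (* Since labels are 1, 2 or 3, the comparisons with 1 and then with 2 decide which one it is. *)
  have := labP jn (_ : (kk - u < k)%N); rewrite -r313 => /(_ ltac:(lia)) l123.
  apply: (@wp_ifI _ _ _ _ _ 4) => //; rewrite (frameE F3) => l1.
    have {l123}l1 : r3 13%N = 1.
      by move: l123 l1; rewrite !inE => /or3P[]/eqP-> //; lra.
    apply: wp_blockI => //=; rewrite /exec1 /=; split=> //=.
    - by apply: frame_upd.
    - rewrite /upd /= r319 r318 r320 /part uj -r313 l1 eqxx /=.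
      by rewrite ifF ?addr0 //; apply/eqP; lra.
  apply: (@wp_ifI _ _ _ _ _ 2) => //; rewrite r314 => l2.
    have {l123}l2 : r3 13%N = 2.
      by move: l123 l1 l2; rewrite !inE => /or3P[]/eqP-> //; lra.
    apply: wp_blockI => //=; rewrite /exec1 /=; split=> //=.
    - by apply: frame_upd.
    - rewrite /upd /= r319 r318 r320 /part uj -r313 l2 eqxx /=.
      by rewrite ifF ?addr0 //; apply/eqP; lra.
  apply: wp_blockI => //=; split=> //.
  rewrite r319 r320 /part uj -r313 /= !ifF ?addr0 //; apply/eqP; lra.
- move=> r2 m2 [F2 r10 kr [r19 r20] ->]; split=> //.
  by rewrite r10 (frameE F2) ltr_nat.
Qed.

Definition score (j : nat) : R :=
  Num.max (eval_arith Div (part_sum 1 j) (part_sum 2 j))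
          (eval_arith Div (part_sum 2 j) (part_sum 1 j)).

(** A score of at least 1 means that both sides contain items of the instance; the value [B] stands
    for no such answer so far. *)
Definition best_inv (j : nat) (r : nat -> R) : Prop :=
  exists2 jb, [/\ (jb < n)%N & r 17%N = jb%:R] &
    (r 16%N = B \/ 1 <= score jb /\ r 16%N = score jb) /\
    (forall j', (j' < j)%N -> 1 <= score j' -> r 16%N <= score j').

Lemma wp_keep_best j r m : (j < n)%N -> frame r -> r 15%N = j%:R ->
  best_inv j r -> r 19%N = part_sum 1 j -> r 20%N = part_sum 2 j ->
  wp keep_best 12
    (fun r' m' => [/\ frame r', r' 15%N = j%:R, best_inv j.+1 r' & m' = m]) r m.
Proof.
move=> jn F r15 [jb [jbn r17] [r16 best]] r19 r20.
pose I1 r' m' := [/\ frame r', keeps r r',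
  r' 11%N = eval_arith Div (part_sum 1 j) (part_sum 2 j),
  r' 12%N = eval_arith Div (part_sum 2 j) (part_sum 1 j) & m' = m].
apply: (@wp_seqI _ _ _ 2 10 _ I1) => //.
  apply: wp_blockI => //=; rewrite /exec1 /=; split=> //=.
  - by do 2?apply: frame_upd.
  - by rewrite /upd /= r19 r20.
  - by rewrite /upd /= r19 r20.
move=> r1 m1 [F1 k1 r11 r12 ->].
pose I2 r' m' := [/\ frame r', keeps r r', r' 11%N = score j & m' = m].
apply: (@wp_seqI _ _ _ 3 6 _ I2) => //.
  apply: (@wp_ifI _ _ _ _ _ 1) => // H.
    apply: wp_blockI => //=; rewrite /exec1 /=; split=> //=.
    - by apply: frame_upd.
    - rewrite /upd /= (frameE F1) addr0 r12 /score; apply/esym/max_idPr.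
      by rewrite -r11 -r12.
  apply: wp_blockI => //=; split=> //; rewrite r11 /score; apply/esym/max_idPl.
  by rewrite -r11 -r12 ltW.
move=> r2 m2 [F2 [k15 k16 k17] r211 ->].
have skip T : ~~ (1 <= score j) \/ r 16%N < score j ->
    wp (Block [::]) T (fun r' m' => [/\ frame r', r' 15%N = j%:R,
      best_inv j.+1 r' & m' = m]) r2 m.
  move=> H; apply: wp_blockI => //=; split=> //; first by rewrite k15.
  exists jb; rewrite ?k16 ?k17; split=> // j'; rewrite ltnS leq_eqVlt.
  case/orP => [/eqP->|]; last exact: best.
  by case: H => [/negPf->|/ltW].
apply: (@wp_ifI _ _ _ _ _ 4) => //; rewrite (frameE F2) r211 => s1; last first.
  by apply: skip; left; rewrite -ltNge.
apply: (@wp_ifI _ _ _ _ _ 2) => //; rewrite r211 k16 => s2; last first.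
  by apply: skip; right.
apply: wp_blockI => //=; rewrite /exec1 /=; split=> //=.
- by do 2?apply: frame_upd.
- by rewrite /upd /= k15.
exists j; first by split=> //; rewrite /upd /= (frameE F2) addr0 k15.
rewrite /upd /= (frameE F2) addr0 r211; split; first by right.
move=> j'; rewrite ltnS leq_eqVlt => /orP[/eqP->//|j'j] H.
by apply: le_trans s2 _; apply: best.
Qed.

Definition out_label (jb i : nat) : R :=
  if (i <= jb < i + k)%N then lab jb (kk - (jb - i)) else 3.

Lemma wp_write_out jb r m : (jb < n)%N -> frame r -> r 17%N = jb%:R ->
  (forall t, (t < k)%N -> m (phi N jb (k + t)) = lab jb t) ->
  wp write_out (5 * n + 14 * k + 8)
    (fun _ m' => forall i, (i < n)%N -> m' (n + i)%N = out_label jb i) r m.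
Proof.
move=> jbn F r17 ml.
pose I1 u r' m' := [/\ frame r', r' 10%N = u%:R, r' 13%N = 3, r' 17%N = jb%:R &
  (forall i, (i < u)%N -> m' (n + i)%N = 3) /\
  (forall x, m' (phi N jb x) = m (phi N jb x))].
apply: (@wp_seqI _ _ _ 2 (5 * n + 14 * k + 6) _ (I1 0%N)); last by lia.
  by apply: wp_blockI => //=; rewrite /exec1 /=; split=> //=; do 2?apply: frame_upd.
move=> r1 m1 I0.
apply: (@wp_seqI _ _ _ (5 * n + 2) (14 * k + 4) _ (I1 n)); last by lia.
  apply: (@wp_whileI _ I1 n _ _ _ 3 _ _ _ _ I0); last by lia.
  - move=> u r2 m2 un [F2 r10 r13 r217 [m3 mphi]]; split.
      by rewrite r10 (frameE F2) le_pred.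
    apply: wp_blockI => //=; rewrite /exec1 /=; split=> //=.
    + by do 2?apply: frame_upd.
    + by rewrite /upd /= r10 (frameE F2) natr1.
    + rewrite !updS (frameE F2) r10 -natrD natrK; split=> [i|x].
        rewrite ltnS leq_eqVlt => /orP[/eqP->|iu]; rewrite /upd ?eqxx //=.
        by rewrite ifF ?m3 //; lia.
      by rewrite updN ?mphi //; have := phi_ge jb x; rewrite /N; lia.
  - move=> r2 m2 I2; split=> //; case: I2 => F2 r10 _ _ _.
    by rewrite ltNge r10 (frameE F2) le_pred ltnn.
move=> r2 m2 {I0}[F2 r10 r13 r217 [m3 mphi]].
pose I2 u r' m' := [/\ frame r', r' 10%N = u%:R, r' 15%N = jb%:R,
  (forall i, (i < n)%N -> m' (n + i)%N =
     if (i <= jb < i + u)%N then lab jb (kk - (jb - i)) else 3) &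
  (forall x, m' (phi N jb x) = m (phi N jb x))].
apply: (@wp_seqI _ _ _ 2 (14 * k + 2) _ (I2 0%N)); last by lia.
  apply: wp_blockI => //=; rewrite /exec1 /=; split=> //=.
  - by do 2?apply: frame_upd.
  - by rewrite /upd /= r217 (frameE F2) addr0.
  - by move=> i i_n; rewrite m3 // ifF //; lia.
move=> r3 m4 I0.
apply: (@wp_whileI _ I2 k _ _ _ 12 _ _ _ _ I0); last by lia.
- move=> u r4 m5 uk [F4 r410 r415 mo mp]; split.
    by rewrite r410 (frameE F4) ler_nat; lia.
  pose I3 r' m' := [/\ frame r', r' 10%N = u%:R, r' 15%N = jb%:R,
    (forall i, (i < n)%N -> m' (n + i)%N =
       if (i <= jb < i + u.+1)%N then lab jb (kk - (jb - i)) else 3) &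
    (forall x, m' (phi N jb x) = m (phi N jb x))].
  apply: (@wp_seqI _ _ _ 11 1 _ I3) => //; last first.
    move=> r5 m6 [F5 r510 r515 mo5 mp5].
    apply: wp_blockI => //=; rewrite /exec1 /=; split=> //=.
    - by apply: frame_upd.
    - by rewrite /upd /= r510 (frameE F5) natr1.
  apply: (@wp_ifI _ _ _ _ _ 9) => //; rewrite r410 r415 ?ler_nat ?ltr_nat => uj;
    last first.
    apply: wp_blockI => //=; split=> // i i_n; rewrite mo //.
    by congr (if _ then _ else _); lia.
  apply: wp_blockI => //.
  rewrite -[X in exec_block X]/(load_label ++
    [:: IArith Sub 11 15 10; IArith Add 11 11 0; IStore 11 13]).
  rewrite !exec_block_cat.
  have uk' : (u <= kk)%N by lia.
  have [v ->] := @exec_load_label jb u r4 m5 uk' F4 r410 r415.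
  rewrite mp ml; last by lia.
  rewrite /= /exec1 /= !updS.
  have -> : upd (upd (upd (upd r4 12 v) 13 (lab jb (kk - u))) 11
     (upd (upd r4 12 v) 13 (lab jb (kk - u)) 15 -
      upd (upd r4 12 v) 13 (lab jb (kk - u)) 10)) 11
     (upd (upd r4 12 v) 13 (lab jb (kk - u)) 15 -
      upd (upd r4 12 v) 13 (lab jb (kk - u)) 10 +
      upd (upd (upd r4 12 v) 13 (lab jb (kk - u))) 11
        (upd (upd r4 12 v) 13 (lab jb (kk - u)) 15 -
         upd (upd r4 12 v) 13 (lab jb (kk - u)) 10) 0) 13 = lab jb (kk - u).
    by rewrite /upd.
  have -> : upd (upd r4 12 v) 13 (lab jb (kk - u)) 15 -
      upd (upd r4 12 v) 13 (lab jb (kk - u)) 10 +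
      upd (upd (upd r4 12 v) 13 (lab jb (kk - u))) 11
        (upd (upd r4 12 v) 13 (lab jb (kk - u)) 15 -
         upd (upd r4 12 v) 13 (lab jb (kk - u)) 10) 0 = (n + (jb - u))%:R.
    by rewrite /upd /= r410 r415 (frameE F4) natrD natrB // addrC.
  rewrite natrK; split=> //=.
  + by do 4?apply: frame_upd.
  + move=> i i_n; rewrite /upd eqn_add2l; case: eqP => [->|iE].
      by rewrite ifT; [congr lab; lia | lia].
    by rewrite mo //; congr (if _ then _ else _); lia.
  + by move=> x; rewrite updN ?mp //; have := phi_ge jb x; rewrite /N; lia.
- move=> r4 m5 [F4 r410 _ mo _]; split; last by [].
  by rewrite r410 (frameE F4) ltr_nat.
Qed.

(** * The main loop *)

Section MainLoop.
Variables (pL : program) (tau : nat).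
Hypothesis q_ge2 : (2 <= q)%N.
Hypothesis simP : forall j, (j < n)%N -> exists t (s : state R),
  [/\ pc s = 0%N, (forall d, reg s d =
        if d == 0%N then k%:R else if d == 1%N then eps / 3 else 0),
     (forall x, mem s x = if (x < k)%N then padded (j + x) else 0),
     halted pL (run pL t s) &
     [/\ (t <= tau)%N, (forall x, (x < k)%N -> mem (run pL t s) (k + x) = lab j x) &
        forall d, (q <= d)%N -> reg (run pL t s) d = 0]].

Definition main_inv (j : nat) r m : Prop :=
  [/\ frame r, r 15%N = j%:R, best_inv j r, (forall i, (i < n)%N -> m i = a i) &
     (forall j' x, (j <= j' < n)%N -> m (phi N j' x) = 0) /\
     (forall j' t, (j' < j)%N -> (t < k)%N -> m (phi N j' (k + t)) = lab j' t)].

Lemma wp_main_body j r m : (j < n)%N -> main_inv j r m ->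
  wp (main_body pL q) (36 * k + 7 * tau + q + 23) (main_inv j.+1) r m.
Proof.
move=> jn [F r15 Hbest ma [m0 ml]].
have best_keeps r' : keeps r r' -> best_inv j r'.
  move=> [_ k16 k17]; case: Hbest => jb Hjb H; exists jb; first by rewrite k17.
  by rewrite k16.
have jN : (j < N)%N by rewrite /N; lia.
have not_phi i x : (i < n)%N -> i != phi N j x.
  by have := phi_ge j x; rewrite /N; lia.
have not_phi' j' x' x : (j' < n)%N -> j' <> j -> phi N j' x' != phi N j x.
  by move=> j'n jj; apply/eqP => /phi_inj[||//]; rewrite /N; lia.
apply: (wp_seqI (wp_fill jn F r15 ma _)); [| |].
  by move=> x; apply: m0; rewrite leqnn.
2: by apply: (_ : _ + (21 * k + 7 * tau + q + 20) <= _)%N; lia.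
move=> r1 m1 [F1 k1 mphi1 moth1].
apply: (wp_seqI (wp_reset m1 q_ge2 F1)).
2: by apply: (_ : _ + (21 * k + 7 * tau + 18) <= _)%N; lia.
move=> r2 _ [F2 k2 r2hi ->].
have {}k2 : keeps r r2 := keeps_trans k1 k2.
have [t [s [pcs rs ms ht [tt ls hs]]]] := simP jn.
have r215 : r2 15%N = j%:R by case: k2 => ->.
have sw : wp (Sim pL) (7 * t) (sim_rel N j r2 m1 (run pL t s)) r2 m1.
  apply: wp_sim => //; rewrite ?(frameE F2) //.
  - by move=> d; rewrite r2hi rs.
  - by move=> x; rewrite mphi1 ms.
apply: (wp_seqI sw).
2: by apply: (_ : _ + (21 * k + 18) <= _)%N; lia.
move=> r3 m3 [r3hi r3low m3phi m3oth].
have F3 : frame r3.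
  (* The simulated run leaves the registers from [q] on at 0, which restores the frame for the next
     window. *)
  split=> d Hd; last by rewrite r3hi hs.
  by rewrite r3low ?F2.1 //; lia.
have k3 : keeps r r3 by apply: keeps_trans k2 _; split; apply: r3low.
have r315 : r3 15%N = j%:R by case: k3 => ->.
have ma3 i : (i < n)%N -> m3 i = a i.
  by move=> i_n; rewrite m3oth ?moth1 ?ma // => x; apply: not_phi.
have ml3 x : (x < k)%N -> m3 (phi N j (k + x)) = lab j x.
  by move=> xk; rewrite m3phi ls.
apply: (wp_seqI (wp_add_up jn F3 r315 ma3 ml3)).
2: by apply: (_ : _ + 13 <= _)%N; lia.
move=> r4 _ [F4 k4 r419 r420 ->].
have {}k4 : keeps r r4 := keeps_trans k3 k4.
have r415 : r4 15%N = j%:R by case: k4 => ->.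
apply: (wp_seqI (@wp_keep_best j r4 m3 jn F4 r415 (best_keeps _ k4) r419 r420)).
2: by apply: (_ : _ + 1 <= _)%N.
move=> r5 _ [F5 r515 b5 ->].
apply: wp_blockI => //=; rewrite /exec1 /=; split=> //.
- by apply: frame_upd.
- by rewrite /upd /= r515 (frameE F5) natr1.
split=> [j' x j'n|j' x j'j xk].
  by rewrite m3oth ?moth1 ?m0 //; try (by move=> y; apply: not_phi'; lia); lia.
move: j'j; rewrite ltnS leq_eqVlt => /orP[/eqP->|j'j]; first exact: ml3.
rewrite m3oth ?moth1 ?ml //; try (by move=> y; apply: not_phi'; lia); lia.
Qed.

Lemma wp_main r m : main_inv 0 r m ->
  wp (While 15 8 (main_body pL q)) (n * (36 * k + 7 * tau + q + 25) + 2) (main_inv n) r m.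
Proof.
move=> I0.
apply: (@wp_whileI _ main_inv n _ _ _ (36 * k + 7 * tau + q + 23) _ _ _ _ I0).
- move=> u r1 m1 un I1; split; last exact: wp_main_body.
  by case: I1 => F1 -> _ _ _; rewrite (frameE F1) le_pred.
- move=> r1 m1 I1; split=> //.
  by case: I1 => F1 -> _ _ _; rewrite ltNge (frameE F1) le_pred ltnn.
- by rewrite leq_add2r leq_mul2l; apply/orP; right; lia.
Qed.

(** The first two hypotheses say that [L] is the least number of doublings taking [eps] above 1,
    hence the exact number of rounds of the loop. *)
Lemma wp_prelude L r m :
  (forall u, (u < L)%N -> 2 ^+ u * eps <= 1) -> 1 < 2 ^+ L * eps ->
  kk = ((2 * L + 10) * (2 * L + 10))%N ->
  a 0%N * eps != 0 -> B = 100 * a 1%N / (a 0%N * eps) ->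
  r 0%N = n%:R -> r 1%N = eps -> (forall d, (2 <= d)%N -> r d = 0) ->
  m 0%N = a 0%N -> m 1%N = a 1%N ->
  wp prelude (4 * L + 24)
    (fun r' m' => [/\ frame r', r' 15%N = 0, r' 16%N = B, r' 17%N = 0 & m' = m]) r m.
Proof.
move=> small big kkE a0e BE r0 r1 rhi m0 m1.
pose I u r' m' := [/\ r' 0%N = n%:R, r' 1%N = eps, r' 2%N = 0 /\ r' 3%N = 1,
  r' 11%N = 2 ^+ u * eps /\ r' 12%N = u%:R &
  (forall d, (32 <= d)%N -> r' d = 0) /\ m' = m].
apply: (@wp_seqI _ _ _ 4 (4 * L + 20) _ (I 0%N)); last by lia.
  apply: wp_blockI => //=; rewrite /exec1 /=; split=> //=.
  - by rewrite /upd /= r1 addr0 expr0 mul1r.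
  - by split=> // d d32; rewrite !updN ?rhi //; lia.
move=> r2 m2 I0.
apply: (@wp_seqI _ _ _ (4 * L + 2) 18 _ (I L)); last by lia.
  apply: (@wp_whileI _ I L _ _ _ 2 _ _ _ _ I0); last by lia.
  - move=> u r3 m3 uL [r30 r31 [r32 r33] [r311 r312] [r3hi ->]]; split.
      by rewrite r311 r33 small.
    apply: wp_blockI => //=; rewrite /exec1 /=; split=> //=.
    + by rewrite /upd /= r312 r33 r311 natr1 exprS; split=> //; ring.
    + by split=> // d d32; rewrite !updN ?r3hi //; lia.
  - move=> r3 m3 I3; split=> //.
    by case: I3 => _ _ [_ ->] [-> _] _.
move=> r3 m3 [r30 r31 [r32 r33] [r311 r312] [r3hi ->]].
have sE : (L%:R + L%:R + 10%:~R : R) = (2 * L + 10)%:R.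
  by rewrite natrD natrM mulr_natl mulr2n.
pose J1 r' m' := [/\ r' 0%N = n%:R, r' 1%N = eps, r' 2%N = 0 /\ r' 3%N = 1,
  [/\ r' 4%N = N%:R, r' 5%N = k%:R & r' 9%N = kk%:R] &
  (forall d, (32 <= d)%N -> r' d = 0) /\ m' = m].
apply: (@wp_seqI _ _ _ 6 12 _ J1) => //.
  apply: wp_blockI => //=; rewrite /exec1 /=; split=> //=.
  - rewrite /upd /= r30 r312 r33 sE -natrM -kkE natr1 -natrD.
    by split=> //; rewrite addnn -mul2n.
  - by split=> // d d32; rewrite !updN ?r3hi //; lia.
move=> {r30 r31 r32 r33 r311 r312 r3hi} {}r3 {}m3.
move=> [r30 r31 [r32 r33] [r34 r35 r39] [r3hi ->]].
pose J2 r' m' := [/\ r' 0%N = n%:R, r' 1%N = eps, r' 2%N = 0 /\ r' 3%N = 1,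
  [/\ r' 4%N = N%:R, r' 5%N = k%:R, r' 6%N = eps / 3, r' 8%N = n%:R - 1 &
      r' 9%N = kk%:R] &
  [/\ r' 13%N = a 0%N, r' 14%N = a 1%N, (forall d, (32 <= d)%N -> r' d = 0) &
      m' = m]].
apply: (@wp_seqI _ _ _ 5 7 _ J2) => //.
  apply: wp_blockI => //=; rewrite /exec1 /=; split=> //=.
  - rewrite /upd /= r30 r31 r33; split=> //.
    by rewrite ifF //; apply/eqP => /eqP; rewrite (@pnatr_eq0 _ 3).
  - rewrite /upd /= r32 r33 truncn0 truncn1 m0 m1; split=> // d d32.
    by rewrite !ifF ?r3hi //; lia.
move=> {r30 r31 r32 r33 r34 r35 r39 r3hi} {}r3 {}m3.
move=> [r30 r31 [r32 r33] [r34 r35 r36 r38 r39] [r313 r314 r3hi ->]].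
pose J3 r' m' := [/\ frame r' & m' = m].
apply: (@wp_seqI _ _ _ 4 3 _ J3) => //.
  apply: wp_blockI => //=; rewrite /exec1 /=; split=> //=.
  split=> d Hd; last by rewrite !updN ?r3hi //; lia.
  case: d Hd => [|[|[|[|[|[|[|[|[|[|//]]]]]]]]]] // _; rewrite /upd /env //=.
  by rewrite r31 r313 r314 (negPf a0e) BE.
move=> r4 m4 [F3 ->]; apply: wp_blockI => //=; rewrite /exec1 /=; split=> //=.
- by do 3?apply: frame_upd.
- by rewrite /upd /= !(frameE F3) addr0.
Qed.

Lemma wp_SSR_cmd L r m : (2 <= n)%N ->
  (forall u, (u < L)%N -> 2 ^+ u * eps <= 1) -> 1 < 2 ^+ L * eps ->
  kk = ((2 * L + 10) * (2 * L + 10))%N -> (k <= tau)%N ->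
  a 0%N * eps != 0 -> B = 100 * a 1%N / (a 0%N * eps) ->
  r 0%N = n%:R -> r 1%N = eps -> (forall d, (2 <= d)%N -> r d = 0) ->
  (forall i, (i < n)%N -> m i = a i) -> (forall i, (n <= i)%N -> m i = 0) ->
  wp (SSR_cmd pL q) ((125 + q) * (n * tau)) (fun _ m' => exists jb beta,
    [/\ (jb < n)%N, beta = B \/ 1 <= score jb /\ beta = score jb,
       (forall j, (j < n)%N -> 1 <= score j -> beta <= score j) &
       forall i, (i < n)%N -> m' (n + i)%N = out_label jb i]) r m.
Proof.
move=> n2 small big kkE ktau a0e BE r0 r1 rhi ma m0.
have tau0 : (0 < tau)%N by lia.
have Lk : (L <= k)%N by rewrite /k kkE; nia.
have a0 := ma 0%N n_gt0; have a1 := ma 1%N n2.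
pose T2 := (n * (36 * k + 7 * tau + q + 25) + 2)%N.
apply: (@wp_seqI _ _ _ (4 * L + 24) (T2 + (5 * n + 14 * k + 8)) _ _ _ _ _
  (wp_prelude small big kkE a0e BE r0 r1 rhi a0 a1)); last first.
  (* As [n >= 1] and each of 1, [L] and [k] is at most [tau], every term is at most its coefficient
     times [n * tau]; the coefficients add up to 4 + 24 + 36 + 7 + 25 + 2 + 5 + 14 + 8 = 125, plus
     [q]. *)
  rewrite /T2.
  have := leq_mul (leqnn n) ktau.
  have := leq_mul n_gt0 tau0; have := leq_mul n_gt0 ktau.
  have := leq_mul (leqnn n) tau0; have := leq_mul n_gt0 (leqnn tau).
  have := leq_mul (leqnn q) (leq_mul n_gt0 tau0).
  have := leq_mul (leqnn q) (leq_mul (leqnn n) tau0).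
  move: ktau Lk; clearbody k; lia.
move=> r' _ [F r15 r16 r17 ->].
apply: (@wp_seqI _ _ _ T2 (5 * n + 14 * k + 8) _ (main_inv n)) => //.
  apply: wp_main; split=> //.
    by exists 0%N => //; split=> //; left.
  split=> // j' x _; apply: m0; have := phi_ge j' x; rewrite /N; lia.
move=> r2 m2 [F2 _ [jb [jbn r217] [Hb best]] _ [_ ml]].
have ml' t : (t < k)%N -> m2 (phi N jb (k + t)) = lab jb t.
  by move=> tk; apply: ml.
apply: (wp_weaken (wp_write_out jbn F2 r217 ml')) => // r3 m3 Hm.
by exists jb, (r2 16%N); split.
Qed.

End MainLoop.

End ProgramCorrectness.

(** * Restriction to windows *)

Section Balanced.
Variable R : realType.

(* [max (x / y) (y / x) <= c] without division. *)
Definition balanced (c x y : R) : Prop := [/\ 0 < x, 0 < y, x <= c * y & y <= c * x].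

Lemma balanced_sym c x y : balanced c x y -> balanced c y x.
Proof. by case. Qed.

Lemma balanced_ge1 c x y : balanced c x y -> 1 <= c.
Proof.
case=> x0 y0 xy yx; rewrite leNgt; apply/negP => c1; nra.
Qed.

Lemma balanced_le c d x y : c <= d -> balanced c x y -> balanced d x y.
Proof.
move=> cd [x0 y0 xy yx]; split=> //.
- by apply: le_trans xy _; rewrite ler_pM2r.
- by apply: le_trans yx _; rewrite ler_pM2r.
Qed.

End Balanced.

Section WindowReduction.
Variables (R : realType) (n : nat) (a : nat -> R).
Hypothesis a_gt0 : forall i, (i < n)%N -> 0 < a i.
Hypothesis a_lt : forall i j, (i < j < n)%N -> a i < a j.
Implicit Types A B W : {set 'I_n}.

Definition weight A : R := \sum_(i in A) a i.

Lemma items_le i j : (i <= j < n)%N -> a i <= a j.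
Proof.
move=> /andP[]; rewrite leq_eqVlt => /orP[/eqP->//|ij jn].
by apply/ltW/a_lt; rewrite ij.
Qed.

Lemma weight_ge0 A : 0 <= weight A.
Proof. by apply: sumr_ge0 => i _; apply/ltW/a_gt0. Qed.

Lemma weight_ge A (i : 'I_n) : i \in A -> a i <= weight A.
Proof.
move=> iA; rewrite /weight (bigD1 i) //= lerDl sumr_ge0 // => j _.
exact/ltW/a_gt0.
Qed.

Lemma weight_set0 : weight set0 = 0.
Proof. by rewrite /weight big_set0. Qed.

Lemma weight_set1 i : weight [set i] = a i.
Proof. by rewrite /weight big_set1. Qed.

Lemma weight_gt0 A : 0 < weight A -> A != set0.
Proof. by move=> A0; apply/eqP => E; rewrite E weight_set0 ltxx in A0. Qed.

Lemma weight_setID A W : weight A = weight (A :&: W) + weight (A :\: W).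
Proof. by rewrite /weight (big_setID W). Qed.

Lemma card_interval e s : (e + s <= n)%N ->
  #|[set i : 'I_n | (e <= i < e + s)%N]| = s.
Proof.
move=> esn; transitivity (\sum_(e <= i < e + s) 1)%N; last first.
  by rewrite sum_nat_const_nat; lia.
rewrite (big_nat_widen _ _ n) // (big_nat_widenl _ 0) // big_mkord -sum1dep_card.
by apply: eq_bigl => i; rewrite andbC.
Qed.

(** The [s] items lie between [h] and [2h], so subset sums are at most [2hs]. Cells of length
    [d = eps h / 4] number at most [8s / eps + 1], hence at most [8 s 2^L + 1], which is less than
    the number of subsets. Two subsets in one cell differ by less than [d], which is small compared
    with any nonempty side. *)
Lemma pigeonhole (eps : R) L e s : 0 < eps -> eps < 1 -> 1 <= 2 ^+ L * eps ->
  (8 * s * 2 ^ L + 1 < 2 ^ s)%N -> (e + s < n)%N -> a (e + s)%N < 2 * a e ->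
  exists A B, [/\ [disjoint A & B],
    forall i : 'I_n, i \in A :|: B -> (e <= i < e + s)%N &
    balanced (1 + eps / 4) (weight A) (weight B)].
Proof.
move=> eps0 eps1 epsL sbig esn close.
set h := a (e + s)%N / 2; pose d := eps * h / 4.
have h0 : 0 < h by rewrite /h divr_gt0 // a_gt0.
have d0 : 0 < d by rewrite /d; apply: divr_gt0 => //; exact: mulr_gt0.
set W := [set i : 'I_n | (e <= i < e + s)%N].
have cardW : #|W| = s by apply: card_interval; lia.
have item_gt (i : 'I_n) : i \in W -> h < a i.
  rewrite inE => /andP[ei ies]; have := @items_le e i; rewrite ei ltn_ord => /(_ isT).
  by rewrite /h; lra.
have item_le (i : 'I_n) : i \in W -> a i <= 2 * h.
  rewrite inE => /andP[ei ies]; have := @items_le i (e + s)%N.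
  rewrite (ltnW ies) esn => /(_ isT).
  by rewrite /h; lra.
pose M := (8 * s * 2 ^ L)%N.
have weight_le A : A \subset W -> weight A / d < M.+1%:R.
  move=> AW; have wA : weight A <= s%:R * (2 * h).
    apply: le_trans (_ : \sum_(i in A) 2 * h <= _).
      by apply: ler_sum => i /(subsetP AW); apply: item_le.
    rewrite sumr_const -[_ *+ #|A|]mulr_natl ler_pM2r; last by lra.
    by rewrite ler_nat -cardW subset_leq_card.
  rewrite ltr_pdivrMr //; apply: le_lt_trans wA _.
  have -> : M.+1%:R = 8 * s%:R * 2 ^+ L + 1 :> R.
    by rewrite -addn1 natrD !natrM natrX.
  have s0 : 0 <= s%:R :> R by [].
  have : s%:R * (2 * h) * 1 <= s%:R * (2 * h) * (2 ^+ L * eps).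
    by apply: ler_wpM2l epsL; apply: mulr_ge0 => //; lra.
  by rewrite /d; nra.
pose g A : 'I_M.+1 := inord (Num.truncn (weight A / d)).
have gE A : A \subset W -> g A = Num.truncn (weight A / d) :> nat.
  move=> AW; rewrite inordK // truncn_lt_nat; last by rewrite divr_ge0 // ?weight_ge0 ?ltW.
  exact: weight_le.
(* The cell number [g] cannot be injective on the [2 ^ s] subsets of [W]. *)
have /dinjectivePn[A AW [B]] : ~~ dinjectiveb g (powerset W).
  apply/negP => /dinjectiveP inj.
  have := card_in_imset inj; rewrite card_powerset cardW => cE.
  have := max_card (ssrbool.mem (g @: powerset W)); rewrite cE card_ord /M; lia.
rewrite !inE => /andP[BA BW] gAB; rewrite powersetE in AW.
have diff : `|weight A - weight B| < d.
  have /= := congr1 val gAB; rewrite !gE // => tE.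
  have nn C : 0 <= weight C / d by rewrite divr_ge0 // ?weight_ge0 ?ltW.
  have := truncn_itv (nn A); have := truncn_itv (nn B); rewrite tE.
  rewrite -natr1 !ler_pdivlMr // !ltr_pdivrMr // => /andP[? ?] /andP[? ?].
  by rewrite ltr_norml; apply/andP; split; lra.
have diff' : `|weight (A :\: B) - weight (B :\: A)| < d.
  move: diff; rewrite (weight_setID A B) (weight_setID B A) [B :&: A]setIC.
  by congr (`| _ | < _); ring.
have hd : d < h by rewrite /d; nra.
have wgt (C D : {set 'I_n}) : C \subset W -> C :\: D != set0 -> h < weight (C :\: D).
  move=> CW /set0Pn[i iCD]; apply: lt_le_trans (weight_ge iCD).
  by apply/item_gt/(subsetP CW); move: iCD; rewrite inE => /andP[].
(* As [A] and [B] are distinct, one difference is nonempty and weighs more than [h > d]; then the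
   other cannot be empty. *)
have [wA wB] : h < weight (A :\: B) /\ h < weight (B :\: A).
  case: (eqVneq (A :\: B) set0) => AB; case: (eqVneq (B :\: A) set0) => BA'.
  - move: BA; rewrite eqEsubset -!setD_eq0 AB BA' eqxx //.
  - have := wgt _ _ BW BA'; move: diff'.
    by rewrite AB weight_set0 ltr_norml => /andP[? ?]; lra.
  - have := wgt _ _ AW AB; move: diff'.
    by rewrite BA' weight_set0 ltr_norml => /andP[? ?]; lra.
  - by split; apply: wgt.
exists (A :\: B), (B :\: A); split.
- rewrite -setI_eq0; apply/eqP/setP => i; rewrite !inE.
  by case: (i \in A); case: (i \in B).
- move=> i; rewrite !inE => /orP[]/andP[_].
    by move=> /(subsetP AW); rewrite inE.
  by move=> /(subsetP BW); rewrite inE.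
- move: diff'; rewrite ltr_norml /d => /andP[? ?].
  have ? : eps * h <= eps * weight (A :\: B) by rewrite ler_pM2l // ltW.
  have ? : eps * h <= eps * weight (B :\: A) by rewrite ler_pM2l // ltW.
  by split; lra.
Qed.

Section SparseItems.
Variable s : nat.
Hypothesis sparse : forall i, (s <= i < n)%N -> 2 * a (i - s)%N <= a i.

(** The last [s] terms sum to at most [s a_i], and by induction the terms up to [i - s] to at most
    [2 s a_(i-s)], which is again at most [s a_i]. *)
Lemma sparse_prefix i : (0 < s)%N -> (i < n)%N ->
  \sum_(0 <= t < i.+1) a t <= 2 * s%:R * a i.
Proof.
move=> s0; elim/ltn_ind: i => i IH i_n.
have ai0 := a_gt0 i_n.
have run_le lo : (i.+1 - lo <= s)%N -> \sum_(lo <= t < i.+1) a t <= s%:R * a i.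
  move=> los; apply: le_trans (_ : \sum_(lo <= t < i.+1) a i <= _).
    rewrite big_nat [leRHS]big_nat; apply: ler_sum => t /andP[_ ti].
    by apply: items_le; rewrite i_n andbT; lia.
  by rewrite sumr_const_nat -[_ *+ (_ - _)]mulr_natl ler_pM2r // ler_nat.
have [i_s|s_i] := ltnP i s.
  apply: le_trans (run_le 0%N _) _; first by lia.
  by rewrite -mulrA ler_peMl ?mulr_ge0 ?ler1n //; lra.
rewrite (@big_cat_nat _ _ _ (i - s).+1) //=; last by lia.
have := IH (i - s)%N; rewrite ltn_subrL s0 (leq_trans s0 s_i) => /(_ isT).
move=> /(_ (leq_ltn_trans (leq_subr _ _) i_n)).
have /run_le : (i.+1 - (i - s).+1 <= s)%N by lia.
have := @sparse i; rewrite s_i i_n => /(_ isT) H.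
have : s%:R * (2 * a (i - s)%N) <= s%:R * a i by apply: ler_wpM2l.
lra.
Qed.

Lemma sparse_decay D j : (s * D <= j < n)%N -> 2 ^+ D * a (j - s * D)%N <= a j.
Proof.
elim: D => [|D IH] /andP[sj jn]; first by rewrite muln0 subn0 mul1r.
apply: le_trans (IH _); last by rewrite jn andbT; lia.
rewrite exprSr -mulrA ler_pM2l ?exprn_gt0 //.
have -> : (j - s * D.+1 = j - s * D - s)%N by lia.
by apply: sparse; lia.
Qed.

End SparseItems.

Definition in_window (k j i : nat) : bool := (i <= j < i + k)%N.

(** The reason for [s = 2L + 10]: with [2 ^ L] cancelled, [32 (2L + 10) <= 2 ^ (L + 10)] holds at 0
    and the right side doubles with each step. The bound serves both the pigeonhole argument and the
    decay of sparse items. *)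
Lemma two_pow_big L : (32 * (2 * L + 10) * 2 ^ L <= 2 ^ (2 * L + 10))%N.
Proof.
have -> : (2 * L + 10 = L + 10 + L)%N by lia.
rewrite [in leqRHS]expnD leq_mul2r; apply/orP; right.
elim: L => // L IH; rewrite !addSn expnS; lia.
Qed.

Lemma window_reduction (eps c : R) L k A B : 0 < eps < 1 ->
  1 <= 2 ^+ L * eps -> k = ((2 * L + 10) * (2 * L + 10)).+1 ->
  [disjoint A & B] -> balanced c (weight A) (weight B) ->
  exists (j : 'I_n) A' B', [/\ [disjoint A' & B'], j \in A' :|: B',
    forall i : 'I_n, i \in A' :|: B' -> in_window k j i &
    balanced ((1 + eps / 4) * c) (weight A') (weight B')].
Proof.
move=> /andP[eps0 eps1] epsL kE dAB nAB; set s := (2 * L + 10)%N in kE.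
have c1 := balanced_ge1 nAB.
have sbig := two_pow_big L; rewrite -/s in sbig.
have max_index (C : {set 'I_n}) : C != set0 ->
    exists2 j : 'I_n, j \in C & forall i, i \in C -> (i <= j)%N.
  move=> /set0Pn[i0 i0C].
  by case: (arg_maxnP (fun i : 'I_n => i : nat) i0C) => j jC H; exists j.
have [[i /andP[si i_n] close]|sparse] :=
    pselect (exists2 i, (s <= i < n)%N & a i < 2 * a (i - s)%N).
  have es : (i - s + s = i)%N by lia.
  have [|||A' [B' [dis sup nr]]] := @pigeonhole eps L (i - s)%N s eps0 eps1 epsL.
  - have : (0 < 2 ^ L)%N by rewrite expn_gt0.
    by move: sbig; rewrite /s; nia.
  - by rewrite es.
  - by rewrite es.
  have [|j jU jmax] := max_index (A' :|: B').
    case: nr => /weight_gt0 A0 _ _ _; apply: contra_neq A0 => /eqP.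
    by rewrite setU_eq0 => /andP[/eqP].
  exists j, A', B'; split=> //.
    (* Indices within a run of [s] differ by less than [s < k], so the window of the largest
       contains them all. *)
    move=> t tU; have := jmax _ tU; have := sup _ jU; have := sup _ tU.
    by rewrite /in_window kE; nia.
  apply: balanced_le nr; rewrite ler_peMr //; lra.
have {}sparse i : (s <= i < n)%N -> 2 * a (i - s)%N <= a i.
  by move=> Hi; rewrite leNgt; apply/negP => H; apply: sparse; exists i.
have step4 : 32 * s%:R <= 2 ^+ s * eps.
  have : (32 * s * 2 ^ L)%:R <= (2 ^ s)%:R :> R by rewrite ler_nat.
  rewrite !natrM !natrX => H.
  have : 32 * s%:R * 2 ^+ L * eps <= 2 ^+ s * eps by rewrite ler_pM2r.
  have : 32 * s%:R * 1 <= 32 * s%:R * (2 ^+ L * eps).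
    by apply: ler_wpM2l => //; apply: mulr_ge0.
  lra.
have s0 : (0 < s)%N by rewrite /s addn_gt0 orbT.
clearbody s; clear sbig.
have [|j jU jmax] := max_index (A :|: B).
  case: nAB => /weight_gt0 A0 _ _ _; apply: contra_neq A0 => /eqP.
  by rewrite setU_eq0 => /andP[/eqP].
wlog jA : A B dAB nAB jU jmax / j \in A.
  move=> H; move: (jU); rewrite inE => /orP[jA|jB]; first exact: (H A B).
  have [|||||j' [A' [B' [dis jU' sup nr]]]] := H B A.
  - by rewrite disjoint_sym.
  - exact: balanced_sym.
  - by rewrite setUC.
  - by move=> i; rewrite setUC; apply: jmax.
  - by [].
  by exists j', A', B'.
have j0 : (0 < j)%N.
  have /set0Pn[i iB] : B != set0 by apply: weight_gt0; case: nAB.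
  have := jmax i; rewrite inE iB orbT => /(_ isT) ij.
  rewrite lt0n; apply/eqP => j0; move: dAB; rewrite disjoint_subset.
  move=> /subsetP/(_ _ jA); rewrite inE.
  have ji : j = i by apply/val_inj => /=; lia.
  by rewrite ji iB.
have k2 : (1 < k)%N by rewrite kE ltnS muln_gt0 s0.
have j1n : (j.-1 < n)%N by have := ltn_ord j; lia.
pose j1 : 'I_n := Ordinal j1n.
have aj1 : 0 < a j1 by exact: a_gt0.
have aj : a j1 < a j by apply: a_lt; rewrite ltn_ord andbT /=; lia.
have [wA wB wAB wBA] := nAB.
have wAj := weight_ge jA.
have [wB1|wB1] := ltP (weight B) (a j1).
  exists j, [set j], [set j1]; split.
  - by rewrite disjoints1 inE -val_eqE /= gtn_eqF // ltn_predL.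
  - by rewrite !inE eqxx.
  (* Both singletons fit since [k >= 2]. In the next goal, [a_j <= weight A <= c * weight B <= c *
     a_(j-1)], so they are no worse than the given pair. *)
  - move=> i; rewrite !inE => /orP[]/eqP->; rewrite /in_window /=;
      clear -j0 k2; lia.
  - have cc : 0 <= c by lra.
    have e4 : 1 <= 1 + eps / 4 by lra.
    rewrite !weight_set1; apply: (@balanced_le _ c); first by rewrite ler_peMl.
    split=> //; first by lra.
      by apply: le_trans wAj _; apply: le_trans wAB _; apply: ler_wpM2l => //; exact: ltW.
    by apply: le_trans (ltW aj) _; rewrite ler_peMl //; lra.
pose W := [set i : 'I_n | (j < i + k)%N].
have outer (C : {set 'I_n}) : C \subset A :|: B -> weight (C :\: W) <= eps / 16 * a j1.
  (* For [j < k] no index lies below the window. *)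
  move=> CU; have [jk|kj] := ltnP j k.
    have -> : C :\: W = set0.
      apply/setP => i; rewrite !inE -leqNgt; apply/negbTE; rewrite negb_and.
      by rewrite -ltnNge ltn_addl.
    by rewrite weight_set0; apply: mulr_ge0; lra.
  have jkn : (j - k < n)%N := leq_ltn_trans (leq_subr _ _) (ltn_ord j).
  have step1 : weight (C :\: W) <= \sum_(0 <= t < (j - k).+1) a t.
    rewrite (big_nat_widen _ _ n) // big_mkord /weight.
    rewrite big_mkcond [leRHS]big_mkcond; apply: ler_sum => i _.
    have -> : (i < (j - k).+1)%N = (i + k <= j)%N by rewrite ltnS leq_subRL // addnC.
    rewrite !inE -leqNgt.
    by case: (i + k <= j)%N => //=; case: ifP => // _; exact/ltW/a_gt0.
  have step2 := sparse_prefix sparse s0 jkn.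
  (* From [j - k] to [j - 1] there are exactly [s * s] positions, that is, [s] doublings. *)
  have step3 : 2 ^+ s * a (j - k)%N <= a j1.
    have -> : (j - k = j1 - s * s)%N by rewrite kE /=; clear; lia.
    apply: sparse_decay => //; rewrite ltn_ord andbT /=.
    by move: kj; rewrite kE; clear; lia.
  have ajk := a_gt0 jkn.
  have : 32 * s%:R * a (j - k)%N <= 2 ^+ s * eps * a (j - k)%N by rewrite ler_pM2r.
  have : eps * (2 ^+ s * a (j - k)%N) <= eps * a j1 by rewrite ler_pM2l.
  lra.
(* A side of weight at least [a_(j-1)] keeps a fraction [1 - eps / 16], and
   [(1 - eps / 16) (1 + eps / 4) >= 1]. *)
have shrink (C : {set 'I_n}) : C \subset A :|: B -> a j1 <= weight C ->
    [/\ 0 < weight (C :&: W), weight (C :&: W) <= weight C &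
        weight C <= (1 + eps / 4) * weight (C :&: W)].
  move=> CU C1; have := outer C CU; have := weight_setID C W.
  have := weight_ge0 (C :\: W); set x := weight (C :\: W).
  set y := weight (C :&: W); move: C1; set z := weight C => C1 x0 zE xs.
  have ? : eps * a j1 <= eps * z by rewrite ler_pM2l.
  have ? : eps * a j1 <= 1 * a j1 by rewrite ler_pM2r // ltW.
  have ? : eps * (eps * z) <= 1 * (eps * z).
    by rewrite ler_pM2r ?mulr_gt0 //; lra.
  have yz : z * (1 - eps / 16) <= y by lra.
  by split; [lra|lra|nra].
have [||A0 A1 A2] := shrink A; [exact: subsetUl|by lra|].
have [||B0 B1 B2] := shrink B; [exact: subsetUr|by []|].
exists j, (A :&: W), (B :&: W); split.
- by apply: disjointWl (subsetIl _ _) _; apply: disjointWr (subsetIl _ _) _.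
- by rewrite !inE jA /= -[X in (X < _)%N]addn0 ltn_add2l kE.
- move=> i; rewrite -setIUl inE => /andP[iU]; rewrite inE => H.
  by rewrite /in_window jmax.
- split=> //.
  + apply: le_trans A1 _; apply: le_trans wAB _.
    by rewrite [(1 + _) * c]mulrC -mulrA ler_pM2l //; lra.
  + apply: le_trans B1 _; apply: le_trans wBA _.
    by rewrite [(1 + _) * c]mulrC -mulrA ler_pM2l //; lra.
Qed.

End WindowReduction.

(** * Padding *)

Section Padding.
Variables (R : realType) (n kk : nat) (B : R) (a : nat -> R).
Hypothesis n_gt0 : (0 < n)%N.
Hypothesis B_ge2 : 2 <= B.
Hypothesis a_gt0 : forall i, (i < n)%N -> 0 < a i.
Hypothesis a_lt : forall i j, (i < j < n)%N -> a i < a j.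

Let k := kk.+1.
Let b := padded kk B a.

Lemma base_gt0 : 0 < B. Proof. by move: B_ge2; lra. Qed.

Lemma padded_gt0 u : (u < n + kk)%N -> 0 < b u.
Proof.
move=> un; rewrite /b /padded; case: ifP => kku.
  by apply: a_gt0; lia.
by rewrite divr_gt0 ?exprn_gt0 ?base_gt0 // a_gt0.
Qed.

Lemma padded_lt u v : (u < v < n + kk)%N -> b u < b v.
Proof.
suff bS w : (w.+1 < n + kk)%N -> b w < b w.+1.
  elim: v => // v IH /andP[]; rewrite ltnS leq_eqVlt => /orP[/eqP-> /bS //|uv vn].
  by apply: lt_trans (bS _ vn); apply: IH; rewrite uv /=; lia.
move=> wn; have [wkk|kkw] := ltnP w kk.
  rewrite /b paddedS // ltr_pdivrMr ?base_gt0 // ltr_pMr; last exact: padded_gt0.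
  by move: B_ge2; lra.
rewrite /b /padded kkw ifT; last by lia.
by apply: a_lt; lia.
Qed.

Lemma padded_le u v : (u <= v < n + kk)%N -> b u <= b v.
Proof.
move=> /andP[]; rewrite leq_eqVlt => /orP[/eqP->//|uv vn].
by apply/ltW/padded_lt; rewrite uv.
Qed.

Lemma padded_kk : b kk = a 0%N.
Proof. by rewrite /b /padded leqnn subnn. Qed.

(** A geometric sum of ratio [B >= 2], bounded by means of the first entry above the pads that are
    summed; [minn] stops this entry at index [kk], which holds [a_0]. *)
Lemma pads_below j w :
  \sum_(t < w | (j + t < kk)%N) b (j + t)%N <= 2 / B * b (minn (j + w) kk).
Proof.
elim: w => [|w IH].
  rewrite big_ord0 mulr_ge0 ?divr_ge0 ?ltW ?base_gt0 // padded_gt0 //; lia.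
rewrite big_mkcond big_ord_recr -big_mkcond /=; case: ifP => jw; last first.
  by rewrite addr0 (_ : minn (j + w.+1) kk = minn (j + w) kk) //; lia.
have E1 : minn (j + w) kk = (j + w)%N by lia.
have E2 : minn (j + w.+1) kk = (j + w).+1 by lia.
rewrite E1 in IH; rewrite E2.
have bE : b (j + w).+1 = B * b (j + w)%N.
  by rewrite /b [in RHS]paddedS // mulrC divfK // gt_eqF // base_gt0.
rewrite bE mulrA divfK ?gt_eqF ?base_gt0 //.
have b0 : 0 < b (j + w)%N by apply: padded_gt0; lia.
(* The induction step is [2 / B * b + b <= 2 * b], that is, [B >= 2]. *)
suff : 2 / B * b (j + w)%N <= 1 * b (j + w)%N by lra.
by rewrite ler_pM2r // ler_pdivrMr ?base_gt0 // mul1r.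
Qed.

Section Window.
Variable j : nat.
Hypothesis jn : (j < n)%N.
Implicit Types X Y : {set 'I_k}.

Definition pweight X : R := \sum_(t in X) b (j + t)%N.

Let bt_gt0 (t : 'I_k) : 0 < b (j + t)%N.
Proof. by apply: padded_gt0; have := ltn_ord t; rewrite /k; lia. Qed.

Lemma pweight_ge X (t : 'I_k) : t \in X -> b (j + t)%N <= pweight X.
Proof.
move=> tX; rewrite /pweight (bigD1 t) //= lerDl sumr_ge0 // => i _.
exact/ltW/bt_gt0.
Qed.

Lemma pads_sum X w : (w <= k)%N ->
  (forall t : 'I_k, t \in X -> (t < w)%N && (j + t < kk)%N) ->
  pweight X <= 2 / B * b (minn (j + w) kk).
Proof.
move=> wk HX; apply: le_trans (pads_below j w).
rewrite (big_ord_widen_cond k (fun t => (j + t < kk)%N) (fun t => b (j + t)%N)) //.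
rewrite /pweight big_mkcond [leRHS]big_mkcond; apply: ler_sum => t _.
case: ifP => [/HX/andP[-> ->]|_] //.
by case: ifP => // _; apply/ltW/bt_gt0.
Qed.

Lemma has_real_item c X Y : [disjoint X & Y] -> c < B / 2 ->
  balanced c (pweight X) (pweight Y) -> exists2 t : 'I_k, t \in X & (kk <= j + t)%N.
Proof.
move=> dXY cB [X0 Y0 XY YX].
have [//|noreal] := pselect (exists2 t : 'I_k, t \in X & (kk <= j + t)%N).
have {}noreal (t : 'I_k) : t \in X -> (j + t < kk)%N.
  by move=> tX; rewrite ltnNge; apply/negP => H; apply: noreal; exists t.
exfalso.
have /set0Pn[i0 i0X] : X != set0.
  by apply: contraTneq X0 => ->; rewrite /pweight big_set0 ltxx.
have i0U : i0 \in X :|: Y by rewrite inE i0X.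
(* The largest item of the pair exceeds all pads below it together by a factor
   [B / 2], and the side without it consists of such pads. *)
case: (arg_maxnP (fun i : 'I_k => i : nat) i0U) => w wU wmax.
have far (X' Y' : {set 'I_k}) : w \in Y' -> w \notin X' ->
    (forall t : 'I_k, t \in X' -> t \in X :|: Y /\ (j + t < kk)%N) ->
    B / 2 * pweight X' <= pweight Y'.
  move=> wY wX HX.
  have H1 : pweight X' <= 2 / B * b (minn (j + w) kk).
    apply: pads_sum => [|t tX]; first exact/ltnW/ltn_ord.
    have [tU ->] := HX t tX; have tw : (t <= w)%N := wmax _ tU.
    rewrite andbT ltn_neqAle tw andbT.
    by apply: contraNneq wX => /val_inj <-.
  have H2 : b (minn (j + w) kk) <= pweight Y'.
    apply: le_trans (pweight_ge wY); apply: padded_le.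
    by have := ltn_ord w; rewrite /k; move: jn; clear; lia.
  rewrite mulrC -ler_pdivlMr ?divr_gt0 ?base_gt0 // invf_div.
  apply: le_trans H1 _; rewrite mulrC ler_pM2r ?divr_gt0 ?base_gt0 //.
have dis t : t \in X -> t \notin Y by move=> tX; rewrite (disjointFr dXY).
(* If the largest entry lies in [X], it is a pad, so everything in [Y] below it is a pad too; if it
   lies in [Y], the side of pads is [X]. Either way the weights differ by a factor of at least
   [B / 2 > c]. *)
have : w \in X :|: Y := wU; rewrite inE => /orP[wX|wY].
- have : B / 2 * pweight Y <= pweight X.
    apply: far => // [|t tY]; first exact: dis.
    have tU : t \in X :|: Y by rewrite inE tY orbT.
    split=> //; apply: leq_ltn_trans (noreal _ wX).
    by rewrite leq_add2l; apply: wmax.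
  by nra.
- have : B / 2 * pweight X <= pweight Y.
    apply: far => //; first by apply/negP => /dis; rewrite wY.
    by move=> t tX; rewrite inE tX; split=> //; apply: noreal.
  by nra.
Qed.

Definition real_items : {set 'I_k} := [set t : 'I_k | (kk <= j + t)%N].

(** All pads together weigh at most [2 a_0 / B <= eps a_0 / 50], while each side has an item and
    hence real weight at least [a_0]; dropping the pads costs a factor [1 + eps / 50]. *)
Lemma balanced_real_items (eps c : R) X Y : 0 < eps -> 100 / eps <= B ->
  [disjoint X & Y] -> c < B / 2 -> balanced c (pweight X) (pweight Y) ->
  balanced ((1 + eps / 50) * c) (pweight (X :&: real_items)) (pweight (Y :&: real_items)).
Proof.
move=> eps0 epsB dXY cB nXY.
have c1 := balanced_ge1 nXY.
have split_real Z : pweight Z = pweight (Z :&: real_items) + pweight (Z :\: real_items).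
  by rewrite /pweight (big_setID real_items).
have a0 : 0 < a 0%N by exact: a_gt0.
have pads Z : 0 <= pweight (Z :\: real_items) <= eps / 50 * a 0%N.
  apply/andP; split; first by apply: sumr_ge0 => t _; apply/ltW/bt_gt0.
  apply: le_trans (_ : 2 / B * b (minn (j + k) kk) <= _).
    apply: pads_sum => // t; rewrite !inE -ltnNge => /andP[-> _].
    by rewrite andbT; apply: ltn_ord.
  rewrite (_ : minn _ _ = kk); last by rewrite /k; lia.
  rewrite padded_kk ler_pM2r // ler_pdivrMr ?base_gt0 //.
  move: epsB; rewrite ler_pdivrMr // => epsB; lra.
have real_ge (Z : {set 'I_k}) (t : 'I_k) : t \in Z -> (kk <= j + t)%N ->
    a 0%N <= pweight (Z :&: real_items).
  move=> tZ treal; apply: le_trans (_ : b (j + t)%N <= _).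
    rewrite -padded_kk; apply: padded_le; rewrite treal /=.
    by have := ltn_ord t; rewrite /k; lia.
  by apply: pweight_ge; rewrite !inE tZ.
have [t tX treal] := has_real_item dXY cB nXY.
have [|t' tY treal'] := has_real_item _ cB (balanced_sym nXY).
  by rewrite disjoint_sym.
have Xr := real_ge _ _ tX treal; have Yr := real_ge _ _ tY treal'.
have /andP[X0 X1] := pads X; have /andP[Y0 Y1] := pads Y.
have [_ _ XY YX] := nXY.
have grow (Z : {set 'I_k}) : a 0%N <= pweight (Z :&: real_items) ->
    c * pweight Z <= (1 + eps / 50) * c * pweight (Z :&: real_items).
  move=> Z1; rewrite [(1 + _) * c]mulrC -mulrA ler_pM2l; last by lra.
  rewrite split_real; have /andP[_ Z2] := pads Z.
  have : eps * a 0%N <= eps * pweight (Z :&: real_items) by rewrite ler_pM2l.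
  lra.
split; [by lra|by lra| |].
- apply: le_trans (grow Y Yr); apply: le_trans XY; rewrite [leRHS]split_real; lra.
- apply: le_trans (grow X Xr); apply: le_trans YX; rewrite [leRHS]split_real; lra.
Qed.

End Window.
End Padding.

(** * Instances *)

Section Instances.
Variable R : realType.
Implicit Types (J X Y : {fset R}) (s : seq R).

Lemma size_items J : size (items J) = #|` J|%fset.
Proof. by rewrite size_sort. Qed.

Lemma items_sorted J : sorted <%R (items J).
Proof. by rewrite sort_lt_sorted fset_uniq. Qed.

Lemma items_uniq J : uniq (items J).
Proof. by rewrite sort_uniq fset_uniq. Qed.

Lemma mem_items J : items J =i J.
Proof. by move=> x; rewrite mem_sort. Qed.

Lemma item_gt0 J : (forall x, x \in J -> 0 < x) ->
  forall i, (i < #|` J|%fset)%N -> 0 < nth 0 (items J) i.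
Proof.
by move=> J0 i iJ; apply: J0; rewrite -mem_items mem_nth // size_items.
Qed.

Lemma item_lt J i j :
  (i < j < #|` J|%fset)%N -> nth 0 (items J) i < nth 0 (items J) j.
Proof.
move=> /andP[ij jJ]; rewrite lt_sorted_ltn_nth ?items_sorted ?inE ?size_items //.
exact: ltn_trans jJ.
Qed.

Lemma items_seq_fset s : sorted <%R s -> items [fset x in s]%fset = s.
Proof.
move=> ss; apply: lt_sorted_eq => //; first exact: items_sorted.
by move=> x; rewrite mem_items in_fset.
Qed.

Lemma Sigma_items X J : (X `<=` J)%fset ->
  Sigma X = \sum_(0 <= i < #|` J|%fset | nth 0 (items J) i \in X) nth 0 (items J) i.
Proof.
move=> /fsubsetP XJ.
rewrite -size_items -(big_nth 0 (fun x => x \in X) id) -big_filter.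
apply: perm_big; apply: uniq_perm; rewrite ?filter_uniq ?items_uniq ?fset_uniq //.
move=> x; rewrite mem_filter mem_items.
by case: (boolP (x \in X)) => // /XJ ->.
Qed.

Lemma Sigma_weight X J : (X `<=` J)%fset ->
  Sigma X = weight (nth 0 (items J))
    [set i : 'I_(#|` J|%fset) | nth 0 (items J) i \in X].
Proof.
move=> XJ; rewrite (Sigma_items XJ) big_mkord.
by apply: eq_bigl => i; rewrite inE.
Qed.

Lemma output_sub J (s : state R) c : (output J s c `<=` J)%fset.
Proof. exact: fset_sub. Qed.

Lemma mem_output J (s : state R) c i : (i < #|` J|%fset)%N ->
  (nth 0 (items J) i \in output J s c) = (mem s (#|` J|%fset + i) == c%:R).
Proof.
move=> iJ; rewrite in_fsetE /= inE -mem_items mem_nth ?size_items //=.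
by rewrite index_uniq ?items_uniq ?size_items.
Qed.

Lemma Sigma_ge0 X : (forall x, x \in X -> 0 < x) -> 0 <= Sigma X.
Proof.
by move=> X0; rewrite /Sigma big_seq; apply: sumr_ge0 => x /X0/ltW.
Qed.

(** By the convention on division by 0, a finite ratio forces both sums to be positive, as
    [balanced] demands. *)
Lemma ratio_leP X Y c : (forall x, x \in X -> 0 < x) ->
  (forall x, x \in Y -> 0 < x) ->
  (ratio X Y <= c%:E)%E <-> balanced c (Sigma X) (Sigma Y).
Proof.
move=> /Sigma_ge0 X0 /Sigma_ge0 Y0; rewrite /ratio ge_max /divi.
have [->|Yn] := eqVneq (Sigma Y) 0; first by split=> // -[_]; rewrite ltxx.
have [->|Xn] := eqVneq (Sigma X) 0; first by rewrite andbF; split=> // -[]; rewrite ltxx.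
have X1 : 0 < Sigma X by rewrite lt_neqAle eq_sym Xn.
have Y1 : 0 < Sigma Y by rewrite lt_neqAle eq_sym Yn.
by rewrite !lee_fin !ler_pdivrMr //; split=> [/andP[]|[_ _ -> ->]].
Qed.

Lemma ratio_ge0 X Y : (forall x, x \in X -> 0 < x) ->
  (forall x, x \in Y -> 0 < x) -> (0 <= ratio X Y)%E.
Proof.
move=> /Sigma_ge0 X0 /Sigma_ge0 Y0; rewrite /ratio le_max /divi.
by case: ifP => _; [rewrite leey | rewrite lee_fin divr_ge0].
Qed.

Lemma bigmin_attained (disp : Order.disp_t) (T : orderType disp) (I : eqType)
    (s : seq I) (P : pred I) (F : I -> T) (x : T) :
  let m := \big[Order.min/x]_(i <- s | P i) F i in
  m = x \/ exists i, [/\ i \in s, P i & F i = m].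
Proof.
elim: s => [|i s IH] /=; first by rewrite big_nil; left.
rewrite big_cons; case: ifP => Pi; last first.
  by case: IH => [|[i' [H1 H2 H3]]]; [left | right; exists i'; rewrite in_cons H1 orbT].
rewrite minEle; case: ifP => _; first by right; exists i; rewrite mem_head.
by case: IH => [|[i' [H1 H2 H3]]]; [left | right; exists i'; rewrite in_cons H1 orbT].
Qed.

Lemma OPT_le J X Y : (X `<=` J)%fset -> (Y `<=` J)%fset -> [disjoint X & Y]%fset ->
  (OPT J <= ratio X Y)%E.
Proof.
move=> XJ YJ XY; apply: (bigmin_inf_seq _ X) => //; first by rewrite fpowersetE.
by apply: ge_bigmin_seq => //; rewrite fpowersetE.
Qed.

Lemma OPTL_le J X Y : (X `<=` J)%fset -> (Y `<=` J)%fset -> [disjoint X & Y]%fset ->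
  max_of J \in (X `|` Y)%fset -> (OPTL J <= ratio X Y)%E.
Proof.
move=> XJ YJ XY mXY; apply: (bigmin_inf_seq _ X) => //; first by rewrite fpowersetE.
by apply: ge_bigmin_seq; rewrite ?fpowersetE // XY.
Qed.

Lemma max_ofP J x : x \in J -> 0 <= x -> (forall y, y \in J -> y <= x) ->
  max_of J = x.
Proof.
move=> xJ x0 Jx; apply/le_anti/andP; split.
  by rewrite /max_of big_seq; apply: bigmax_le.
by apply: (Order.TotalTheory.le_bigmax_seq _ x).
Qed.

(** The pair of the two smallest items shows that the optimum is finite, hence attained. Its ratio
    [a_1 / a_0] is computable in constant time, and the base [B] is chosen large compared with
    it. *)
Lemma OPT_balanced J (n := #|` J|%fset) (a := nth 0 (items J)) :
  (forall x, x \in J -> 0 < x) -> (2 <= n)%N ->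
  exists c (A B : {set 'I_n}), [/\ OPT J = c%:E, c <= a 1%N / a 0%N,
    [disjoint A & B] & balanced c (weight a A) (weight a B)].
Proof.
move=> J0 n2.
have a0 : 0 < a 0%N by apply: item_gt0 => //; exact: ltnW.
have a01 : a 0%N < a 1%N by apply: item_lt.
have aJ i : (i < n)%N -> a i \in J by move=> i_n; rewrite -mem_items mem_nth // size_items.
have opt_le : (OPT J <= (a 1%N / a 0%N)%:E)%E.
  apply: (@le_trans _ _ (ratio [fset a 0%N]%fset [fset a 1%N]%fset)).
    apply: OPT_le; rewrite ?fsub1set ?aJ //; first exact: ltnW.
    by rewrite fdisjoint1X in_fset1; apply/eqP => E; rewrite E ltxx in a01.
  apply/ratio_leP.
  - by move=> x; rewrite in_fset1 => /eqP->.
  - by move=> x; rewrite in_fset1 => /eqP->; apply: lt_trans a01.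
  rewrite /Sigma !big_seq_fset1; split=> //.
  - exact: lt_trans a01.
  - apply: le_trans (ltW a01) _; rewrite ler_peMl ?(ltW (lt_trans a0 a01)) //.
    by rewrite ler_pdivlMr // mul1r ltW.
  - by rewrite divfK // gt_eqF.
have [X [Y [XJ YJ XY E]]] : exists X Y, [/\ (X `<=` J)%fset, (Y `<=` J)%fset,
    [disjoint X & Y]%fset & ratio X Y = OPT J].
  case: (bigmin_attained (fpowerset J) xpredT (fun X =>
    \big[Order.min/+oo%E]_(Y <- fpowerset J | [disjoint X & Y]%fset) ratio X Y)
    +oo%E); rewrite -/(OPT J).
    by move=> E; rewrite E in opt_le.
  move=> [X [XJ _ E]].
  case: (bigmin_attained (fpowerset J) (fun Y => [disjoint X & Y]%fset)
    (ratio X) +oo%E); rewrite E.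
    by move=> E'; rewrite E' in opt_le.
  by move=> [Y [YJ dXY E']]; exists X, Y; rewrite -!fpowersetE.
have X0 x : x \in X -> 0 < x by move=> /(fsubsetP XJ); apply: J0.
have Y0 x : x \in Y -> 0 < x by move=> /(fsubsetP YJ); apply: J0.
have := ratio_ge0 X0 Y0; have := ratio_leP _ X0 Y0; rewrite E.
case: (OPT J) opt_le => [c| |] // opt_le H _.
have [/(_ (lexx _)) nXY _] := H c.
exists c, [set i : 'I_n | a i \in X], [set i : 'I_n | a i \in Y]; split=> //.
- rewrite -setI_eq0; apply/eqP/setP => i; rewrite !inE.
  by apply/negbTE/negP => /andP[iX]; apply/negP; apply: (fdisjointP XY).
- by move: nXY; rewrite (Sigma_weight XJ) (Sigma_weight YJ).
Qed.

End Instances.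

(** * Memory cells and registers that a program writes *)

Section MachineBounds.
Variable R : realType.

Lemma run_writes (p : program) t (s : state R) :
  exists2 l : seq nat, (size l <= t)%N &
    forall x, x \notin l -> mem (run p t s) x = mem s x.
Proof.
elim: t => [|t [l lt Hl]]; first by exists [::].
have [d Hd] : exists d, forall x, x != d ->
    mem (step p (run p t s)) x = mem (run p t s) x.
  rewrite /step; case: (onth p _) => [i|]; last by exists 0%N.
  case: (run p t s) => l0 r m; case: i; try by exists 0%N.
  by move=> a b; exists (Num.truncn (r a)) => x xd /=; rewrite updN.
exists (d :: l) => //= x; rewrite in_cons negb_or => /andP[xd xl].
by rewrite Hd ?Hl.
Qed.

(** The output cells start at 0, which is not a label, and one step writes at most one cell. *)
Lemma labelled_time (p : program) t (J : {fset R}) eps :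
  labelled J (run p t (init J eps)) -> (#|` J|%fset <= t)%N.
Proof.
move=> lab; have [l lt Hl] := run_writes p t (init J eps).
apply: leq_trans lt; rewrite -(size_iota #|` J|%fset #|` J|%fset).
apply: uniq_leq_size (iota_uniq _ _) _ => x; rewrite mem_iota => /andP[Jx xJ].
apply: contraT => /Hl; have := lab (x - #|` J|%fset)%N.
rewrite subnKC // ltn_subLR // => /(_ xJ) + E; rewrite E /= nth_default ?size_items //.
by rewrite !inE !(eq_sym 0) oner_eq0 !pnatr_eq0.
Qed.

(** Shifted by one, so that 0 stands for no register. *)
Definition written_reg (i : instr) : nat :=
  match i with
  | IConst d _ | IArith _ d _ _ | IFloor d _ | ILoad d _ => d.+1
  | _ => 0
  end.

(** At least 2, because registers 0 and 1 carry the input even if the program never writes them. *)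
Definition reg_bound (p : program) : nat := foldr maxn 2 (map written_reg p).

Lemma reg_bound_ge2 p : (2 <= reg_bound p)%N.
Proof. by elim: p => //= i p IH; rewrite /reg_bound /= leq_max IH orbT. Qed.

Lemma reg_boundP p l i : onth p l = Some i -> (written_reg i <= reg_bound p)%N.
Proof.
rewrite /reg_bound; elim: p l => [|i' p IH] [|l] //=; rewrite leq_max.
  by case=> ->; rewrite leqnn.
by move=> /IH ->; rewrite orbT.
Qed.

Lemma run_reg_high (p : program) t (s : state R) d :
  (reg_bound p <= d)%N -> reg (run p t s) d = reg s d.
Proof.
move=> qd; elim: t => // t <-.
rewrite -[run p t.+1 s]/(step p (run p t s)) /step.
case E: (onth p _) => [i|//]; have := leq_trans (reg_boundP E) qd.
case: (run p t s) => l r m {E}; case: i => //= d' *; rewrite updN //; lia.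
Qed.

Lemma code_at_self (p : program) : code_at p 0 p.
Proof. by move=> i _. Qed.

End MachineBounds.

(** * Sums over the labels of a window *)

Section PartSums.
Variables (R : realType) (n kk : nat) (B : R) (a : nat -> R) (lab : nat -> nat -> R).

(** Reverses the indexing, from the distance below the top to the rank in the window. *)
Lemma part_sumE (c : R) j : part_sum kk a lab c j =
  pweight B a j ([set t : 'I_kk.+1 | lab j t == c] :&: real_items kk j).
Proof.
rewrite /part_sum (reindex_inj rev_ord_inj) /pweight [RHS]big_mkcond.
apply: eq_bigr => t _; rewrite /part !inE /= subSS subKn; last by rewrite -ltnS.
rewrite /padded andbC leq_subLR [(t + _)%N]addnC.
case: ifP => // /andP[_ H]; rewrite H; congr a.
by have := ltn_ord t; move: H; clear; lia.
Qed.

(** The label 3 is excluded because it is also given to all items outside the window. *)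
Lemma weight_out_label (c : R) j : (j < n)%N -> c != 3 ->
  weight a [set i : 'I_n | out_label kk lab j i == c] = part_sum kk a lab c j.
Proof.
move=> jn c3; rewrite /weight /part_sum.
pose P u := (u <= j)%N && (lab j (kk - u) == c).
transitivity (\sum_(u < j.+1 | P u && (u < kk.+1)%N) a (j - u)%N); last first.
  rewrite -(big_mkord (fun u => P u && (u < kk.+1)%N) (fun u => a (j - u)%N)).
  rewrite /part -[RHS]big_mkcond -[RHS](big_mkord P (fun u => a (j - u)%N)).
  rewrite (big_nat_widen 0 j.+1 (j.+1 + kk.+1)) ?leq_addr //.
  rewrite (big_nat_widen 0 kk.+1 (j.+1 + kk.+1)) ?leq_addl //.
  rewrite /=; apply: eq_bigl => u; rewrite /P !ltnS.
  by case: (u <= j)%N; rewrite ?andbF ?andbT.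
rewrite [RHS](reindex_inj rev_ord_inj) /=.
rewrite (eq_bigl (fun i : 'I_n =>
  ((j < i + kk.+1) && (lab j (kk - (j - i)) == c) && (i < j.+1))%N)); last first.
  have c3' : (3 == c :> R) = false by rewrite eq_sym (negPf c3).
  move=> i; rewrite inE /out_label ltnS; case: (i <= j)%N; rewrite ?andbT ?andbF /= ?c3' //.
  by case: (j < _)%N; rewrite /= ?c3'.
rewrite -(big_ord_widen_cond n
  (fun i => (j < i + kk.+1)%N && (lab j (kk - (j - i)) == c)) a jn).
apply: eq_big => [i|i _]; rewrite subSS; last by rewrite subKn // -ltnS.
rewrite /P leq_subr /= andbC; congr (_ && _).
by rewrite ltn_subLR // -ltnS.
Qed.

Lemma out_labelP j i : (j < n)%N ->
  (forall t, (t < kk.+1)%N -> lab j t \in [:: 1; 2; 3]) ->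
  out_label kk lab j i \in [:: 1; 2; 3].
Proof.
move=> jn labP; rewrite /out_label; case: ifP => _; last by rewrite !inE eqxx !orbT.
by apply: labP; rewrite ltnS leq_subr.
Qed.

Lemma score_le (c : R) j :
  balanced c (part_sum kk a lab 1 j) (part_sum kk a lab 2 j) ->
  1 <= score kk a lab j <= c.
Proof.
rewrite /score; set x := part_sum _ _ _ 1 j; set y := part_sum _ _ _ 2 j.
case=> x0 y0 xy yx; rewrite /eval_arith !gt_eqF // le_max ge_max.
rewrite !ler_pdivlMr // !ler_pdivrMr // xy yx !mul1r /= andbT.
exact: le_total.
Qed.

(** If a side is 0, both machine quotients are 0, and the score is not at least 1. *)
Lemma score_balanced j :
  0 <= part_sum kk a lab 1 j -> 0 <= part_sum kk a lab 2 j ->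
  1 <= score kk a lab j ->
  balanced (score kk a lab j) (part_sum kk a lab 1 j) (part_sum kk a lab 2 j).
Proof.
rewrite /score; set x := part_sum _ _ _ 1 j; set y := part_sum _ _ _ 2 j.
move=> x0 y0; rewrite /eval_arith.
have [->|y1] := eqVneq y 0; first by rewrite mul0r if_same maxxx ler10.
have [->|x1] := eqVneq x 0; first by rewrite mul0r maxxx ler10.
have {}x0 : 0 < x by rewrite lt_neqAle eq_sym x1.
have {}y0 : 0 < y by rewrite lt_neqAle eq_sym y1.
by move=> _; split=> //; rewrite -ler_pdivrMr // le_max lexx ?orbT.
Qed.

End PartSums.

(** * Windows as instances *)

Section Windows.
Variables (R : realType) (n kk : nat) (B : R) (a : nat -> R).
Hypothesis n_gt0 : (0 < n)%N.
Hypothesis B_ge2 : 2 <= B.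
Hypothesis a_gt0 : forall i, (i < n)%N -> 0 < a i.
Hypothesis a_lt : forall i j, (i < j < n)%N -> a i < a j.

Let k := kk.+1.

Definition window_seq (j : nat) : seq R := mkseq (fun t => padded kk B a (j + t)) k.

Definition window (j : nat) : {fset R} := [fset x in window_seq j]%fset.

Variable j : nat.
Hypothesis jn : (j < n)%N.

Lemma window_seq_sorted : sorted <%R (window_seq j).
Proof.
rewrite /window_seq /mkseq sorted_map.
apply: sub_in_sorted (allss _) (iota_ltn_sorted 0 k).
move=> x y; rewrite !mem_iota /= add0n => _ yk xy.
by apply: (@padded_lt _ n) => //; move: jn yk xy; rewrite /k; clear; lia.
Qed.

Lemma items_window : items (window j) = window_seq j.
Proof. exact: items_seq_fset window_seq_sorted. Qed.

Lemma card_window : #|` window j|%fset = k.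
Proof. by rewrite -size_items items_window size_mkseq. Qed.

Lemma nth_window t : (t < k)%N -> nth 0 (items (window j)) t = padded kk B a (j + t).
Proof. by move=> tk; rewrite items_window nth_mkseq. Qed.

Lemma window_gt0 x : x \in window j -> 0 < x.
Proof.
rewrite in_fset /= => /mapP[t]; rewrite mem_iota /= add0n => tk ->.
by apply: (@padded_gt0 _ n) => //; move: jn tk; rewrite /k; clear; lia.
Qed.

Lemma mem_window i : in_window k j i -> a i \in window j.
Proof.
move=> /andP[ij jik]; rewrite in_fset /=; apply/mapP; exists (kk - (j - i))%N.
  by rewrite mem_iota /= add0n ltnS leq_subr.
have ikk : (j - i <= kk)%N by move: jik; rewrite /k; clear; lia.
rewrite /padded ifT; last by move: ikk ij; clear; lia.
by congr a; move: ikk ij; clear; lia.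
Qed.

Lemma max_of_window : max_of (window j) = a j.
Proof.
apply: max_ofP.
- by apply: mem_window; rewrite /in_window leqnn /= /k; clear; lia.
- exact/ltW/a_gt0.
- move=> y; rewrite in_fset /= => /mapP[t]; rewrite mem_iota /= add0n => tk ->.
  have -> : a j = padded kk B a (j + kk) by rewrite /padded leq_addl addnK.
  by apply: (@padded_le _ n) => //; move: jn tk; rewrite /k; clear; lia.
Qed.

Lemma Sigma_window_output (s : state R) c :
  Sigma (output (window j) s c) =
  pweight B a j [set t : 'I_k | mem s (k + t) == c%:R].
Proof.
rewrite (Sigma_items (output_sub _ s c)) big_mkord card_window /pweight.
apply: eq_big => [t|t _]; last by rewrite nth_window.
by rewrite mem_output ?card_window // inE.
Qed.

(** The pair of index sets becomes an admissible pair of sets of reals, since [a] is injective and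
    the largest element of the window is [a_j]. *)
Lemma OPTL_window (A A' : {set 'I_n}) c : [disjoint A & A'] ->
  (exists2 i : 'I_n, i \in A :|: A' & i = j :> nat) ->
  (forall i : 'I_n, i \in A :|: A' -> in_window k j i) ->
  balanced c (weight a A) (weight a A') -> (OPTL (window j) <= c%:E)%E.
Proof.
move=> dA [i0 i0U i0E] win bal.
pose aI (i : 'I_n) := a i.
have a_inj : injective aI.
  rewrite /aI => i i' E; apply/val_inj; case: (ltngtP i i') => // H.
    by have := @a_lt i i'; rewrite H ltn_ord E ltxx => /(_ isT).
  by have := @a_lt i' i; rewrite H ltn_ord E ltxx => /(_ isT).
pose im (C : {set 'I_n}) : {fset R} := [fset aI i | i in C]%fset.
have imP (C : {set 'I_n}) x : x \in im C -> exists2 i : 'I_n, i \in C & x = a i.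
  by move=> /imfsetP[i /= iC ->]; exists i.
have imS (C : {set 'I_n}) : Sigma (im C) = weight a C.
  rewrite /Sigma /im big_imfset /=; last by move=> x y _ _ /a_inj.
  by rewrite /weight big_enum.
have sub (C : {set 'I_n}) : C \subset A :|: A' -> (im C `<=` window j)%fset.
  move=> CA; apply/fsubsetP => x /imP[i iC ->].
  by apply/mem_window/win/(subsetP CA).
have subA := sub A (subsetUl _ _); have subA' := sub A' (subsetUr _ _).
apply: (@le_trans _ _ (ratio (im A) (im A'))).
  apply: OPTL_le => //.
    apply/fdisjointP => x /imP[i iA ->]; apply/negP => /imP[i' iA' /a_inj ii].
    by move: iA; rewrite ii (disjointFl dA).
  rewrite max_of_window -i0E in_fsetU; move: i0U; rewrite inE.
  by case/orP => H; apply/orP; [left|right]; apply/imfsetP; exists i0.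
apply/ratio_leP; last by rewrite !imS.
- by move=> x /(fsubsetP subA)/window_gt0.
- by move=> x /(fsubsetP subA')/window_gt0.
Qed.

End Windows.

(** * The reduction *)

Section WindowSize.
Variable R : realType.
Implicit Type eps : R.

(** For [0 < eps < 1] this is the least [L] with [2 ^ L * eps > 1], in agreement with the doubling
    loop. *)
Definition level eps : nat := (trunc_log 2 (Num.truncn eps^-1)).+1.

Definition window_size eps : nat := ((2 * level eps + 10) * (2 * level eps + 10)).+1.

Lemma level_bounds eps : 0 < eps < 1 ->
  2 ^+ (level eps).-1 * eps <= 1 < 2 ^+ level eps * eps.
Proof.
move=> /andP[e0 e1]; set N := Num.truncn eps^-1.
have N0 : (0 < N)%N by rewrite truncn_gt0 invf_ge1 // ltW.
have /andP[lo hi] := @trunc_log_bounds 2 N isT N0.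
have V0 : 0 <= eps^-1 by rewrite invr_ge0 ltW.
have /andP[lo' hi'] := truncn_itv V0.
rewrite -ler_pdivlMr // -ltr_pdivrMr // !div1r /level /=; apply/andP; split.
  by apply: le_trans lo'; rewrite -natrX ler_nat.
by apply: lt_le_trans hi' _; rewrite -natrX ler_nat.
Qed.

Lemma level_small eps u : 0 < eps < 1 -> (u < level eps)%N -> 2 ^+ u * eps <= 1.
Proof.
move=> e01 ul; have /andP[lo _] := level_bounds e01; apply: le_trans lo.
have /andP[e0 _] := e01.
by rewrite ler_pM2r // ler_weXn2l ?ler1n.
Qed.

(** The inequality [ln (1 + x) <= x] at [x = - 1 / 2]. *)
Lemma ln2_ge_half : 1 / 2 <= ln 2 :> R.
Proof.
have := @le_ln1Dx R (- (1 / 2)); rewrite (_ : 1 + - (1 / 2) = 2^-1 :> R); last by lra.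
rewrite lnV ?posrE //; have : (-1 < - (1 / 2) :> R) by lra.
by move=> -> /(_ isT); lra.
Qed.

Lemma window_size_bound eps : 0 < eps < 1 ->
  (window_size eps)%:R <= 200 * (1 + ln (1 / eps) ^+ 2) :> R.
Proof.
move=> e01; have /andP[lo _] := level_bounds e01; have /andP[e0 e1] := e01.
set l := (level eps).-1 in lo.
have lE : level eps = l.+1 by [].
have lam : l%:R * ln 2 <= ln (1 / eps) :> R.
  rewrite mulr_natl -lnXn // ler_ln ?posrE ?exprn_gt0 ?divr_gt0 //.
  by rewrite ler_pdivlMr.
have l0 : 0 <= l%:R :> R by [].
have : l%:R * (1 / 2) <= l%:R * ln 2 :> R by rewrite ler_wpM2l // ln2_ge_half.
have -> : (window_size eps)%:R = (2 * l%:R + 12) * (2 * l%:R + 12) + 1 :> R.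
  by rewrite /window_size lE -natr1 natrM natrD natrM -natr1; ring.
move: lam; set x := ln (1 / eps); set y := l%:R * ln 2 => lam ly.
have : (2 * l%:R + 12) * (2 * l%:R + 12) <= (4 * x + 12) * (4 * x + 12).
  by apply: ler_pM; lra.
(* [(4x + 12)^2 + 1 = 16x^2 + 96x + 145], and [96x <= 48 (1 + x^2)]. *)
by have := sqr_ge0 (x - 1); have := sqr_ge0 x; rewrite !expr2; lra.
Qed.

End WindowSize.

(** * Accuracy of the answer for a window *)

Section WindowAnswer.
Variables (R : realType) (n : nat) (a : nat -> R) (eps c B : R) (kk : nat).
Hypothesis n_gt1 : (1 < n)%N.
Hypothesis a_gt0 : forall i, (i < n)%N -> 0 < a i.
Hypothesis a_lt : forall i j, (i < j < n)%N -> a i < a j.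
Hypothesis eps01 : 0 < eps < 1.
Hypothesis BE : B = 100 * a 1%N / (a 0%N * eps).
Hypothesis c_ge1 : 1 <= c.
Hypothesis c_le : c <= a 1%N / a 0%N.

Lemma baseE : B = 100 / eps * (a 1%N / a 0%N).
Proof.
have /andP[e0 _] := eps01; have a0 := a_gt0 (ltnW n_gt1).
by rewrite BE; field; rewrite !gt_eqF.
Qed.

Lemma base_ge_inv : 100 / eps <= B.
Proof.
have /andP[e0 _] := eps01.
by rewrite baseE ler_peMr ?divr_ge0 ?(ltW e0) // (le_trans c_ge1).
Qed.

Lemma base_ge100 : 100 <= B.
Proof.
have /andP[e0 e1] := eps01; apply: le_trans base_ge_inv.
by rewrite ler_pdivlMr // ler_piMr // ltW.
Qed.

Lemma base_large : 50 * c <= B / 2.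
Proof.
have /andP[e0 e1] := eps01; have cx := c_le.
rewrite baseE; set x := a 1%N / a 0%N in cx *.
have : 100 * x <= 100 / eps * x.
  rewrite ler_pM2r; last by move: c_ge1; lra.
  by rewrite ler_pdivlMr // ler_piMr // ltW.
lra.
Qed.

(** Three losses multiply: [1 + eps / 3] from the given algorithm, [1 + eps / 4] from the
    restriction to a window, and [1 + eps / 50] from dropping the pads. Their product is at most
    [1 + eps]. *)
Lemma window_answer (lab : nat -> nat -> R) (s : state R) (j : nat) : (j < n)%N ->
  (forall t, (t < kk.+1)%N -> mem s (kk.+1 + t) = lab j t) ->
  (ratio (output (window kk B a j) s 1) (output (window kk B a j) s 2) <=
     (1 + eps / 3)%:E * OPTL (window kk B a j))%E ->
  (OPTL (window kk B a j) <= ((1 + eps / 4) * c)%:E)%E ->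
  balanced ((1 + eps) * c) (part_sum kk a lab 1 j) (part_sum kk a lab 2 j).
Proof.
move=> jn labE rat opt; have /andP[e0 e1] := eps01.
have B2 : 2 <= B by have := base_ge100; lra.
have n0 := ltnW n_gt1.
pose c2 := (1 + eps / 3) * ((1 + eps / 4) * c).
have {}rat : (ratio (output (window kk B a j) s 1) (output (window kk B a j) s 2)
    <= c2%:E)%E.
  apply: le_trans rat _; rewrite /c2 EFinM; apply: lee_wpmul2l => //.
  by rewrite lee_fin; lra.
have pos x : x \in window kk B a j -> 0 < x by apply: (@window_gt0 _ n).
have {rat}/ratio_leP bal := rat.
have {}bal : balanced c2 (Sigma (output (window kk B a j) s 1))
    (Sigma (output (window kk B a j) s 2)).
  by apply: bal => x /(fsubsetP (output_sub _ _ _)); apply: pos.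
rewrite !(@Sigma_window_output _ n) // in bal.
have setE (d : nat) : [set t : 'I_kk.+1 | mem s (kk.+1 + t) == d%:R] =
    [set t : 'I_kk.+1 | lab j t == d%:R].
  by apply/setP => t; rewrite !inE labE.
rewrite !setE in bal.
rewrite !(part_sumE _ B).
have ee : eps * eps <= eps by rewrite ler_piMr // ltW.
have c2c : c2 <= (1 + 2 * eps / 3) * c.
  by rewrite /c2 mulrA ler_pM2r; [lra | move: c_ge1; lra].
(* This rules out a side that consists of pads only. *)
have c2B : c2 < B / 2.
  have : (1 + 2 * eps / 3) * c <= 2 * c.
    by rewrite ler_pM2r; [lra | move: c_ge1; lra].
  by have := base_large; move: c_ge1; lra.
have dis : [disjoint [set t : 'I_kk.+1 | lab j t == 1%:R] &
    [set t : 'I_kk.+1 | lab j t == 2%:R]].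
  rewrite -setI_eq0; apply/eqP/setP => t; rewrite !inE.
  apply/negbTE/negP => /andP[/eqP-> /eqP]; lra.
have := balanced_real_items n0 B2 a_gt0 a_lt jn e0 base_ge_inv dis c2B bal.
apply: balanced_le; apply: (@le_trans _ _ ((1 + eps / 50) * ((1 + 2 * eps / 3) * c))).
  by rewrite ler_pM2l //; lra.
by rewrite mulrA ler_pM2r; [lra | move: c_ge1; lra].
Qed.

End WindowAnswer.

Definition SSR_program (pL : program) : program :=
  compile (SSR_cmd pL (reg_bound pL)) 0.

Lemma SSR_program_solves (R : realType) (TL : nat -> R -> R) (pL : program) :
  solves_SSRL pL TL ->
  solves_SSR (SSR_program pL) (fun n eps =>
    (125 + reg_bound pL)%:R * (n%:R * TL (window_size eps) (eps / 3))).
Proof.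
move=> solL J eps J0 n2 eps01; have /andP[e0 e1] := eps01.
set n := #|` J|%fset in n2 *; set a := nth 0 (items J).
set q := reg_bound pL.
set L := level eps; pose kk := ((2 * L + 10) * (2 * L + 10))%N.
have n0 : (0 < n)%N := ltnW n2.
have a_gt0 : forall i, (i < n)%N -> 0 < a i := item_gt0 J0.
have a_lt : forall i j, (i < j < n)%N -> a i < a j by move=> i j; apply: item_lt.
have a00 : 0 < a 0%N by apply: a_gt0.
have [c [A0 [B0 [optE c_le dAB balAB]]]] := OPT_balanced J0 n2.
have c_ge1 := balanced_ge1 balAB.
set B := 100 * a 1%N / (a 0%N * eps).
have B100 : 100 <= B := base_ge100 n2 a_gt0 eps01 (erefl B) c_ge1 c_le.
have B2 : 2 <= B by lra.
have eps3 : 0 < eps / 3 < 1 by lra.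
pose W := window kk B a.
have cardW j : (j < n)%N -> #|` W j|%fset = kk.+1.
  by move=> jn; apply: (@card_window _ n).
(* A halting time for every window, with a dummy value for [j >= n]. *)
have /choice[tf tfP] : forall j, exists t, (j < n)%N ->
    let s := run pL t (init (W j) (eps / 3)) in
    [/\ t%:R <= TL kk.+1 (eps / 3), halted pL s, labelled (W j) s &
      (ratio (output (W j) s 1) (output (W j) s 2) <=
         (1 + eps / 3)%:E * OPTL (W j))%E].
  move=> j; case: (ltnP j n) => jn; last by exists 0%N.
  have [||t] := solL (W j) (eps / 3) _ _ eps3.
  - by move=> x; apply: (@window_gt0 _ n).
  - by rewrite cardW // ltnS muln_gt0 addn_gt0 orbT.
  by rewrite cardW // => H; exists t.
pose fin j := run pL (tf j) (init (W j) (eps / 3)).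
pose lab j t := mem (fin j) (kk.+1 + t).
have labP j t : (j < n)%N -> (t < kk.+1)%N -> lab j t \in [:: 1; 2; 3].
  move=> jn tk; have [_ _ /(_ t) + _] := tfP j jn.
  by rewrite cardW // => /(_ tk).
(* All windows have the same size, so one bound serves every call; it is rounded down to count
   steps. *)
pose tau := Num.truncn (TL kk.+1 (eps / 3)).
have TL0 : 0 <= TL kk.+1 (eps / 3).
  by have [H _ _ _] := tfP 0%N n0; apply: le_trans H.
have tf_tau j : (j < n)%N -> (tf j <= tau)%N.
  by move=> jn; have [H _ _ _] := tfP j jn; rewrite truncn_ge_nat.
have k_tau : (kk.+1 <= tau)%N.
  apply: leq_trans (tf_tau 0%N n0); rewrite -(cardW 0%N n0).
  by have [_ _ /labelled_time] := tfP 0%N n0.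
have simP j : (j < n)%N -> exists t (s : state R),
    [/\ pc s = 0%N, (forall d, reg s d =
          if d == 0%N then kk.+1%:R else if d == 1%N then eps / 3 else 0),
       (forall x, mem s x = if (x < kk.+1)%N then padded kk B a (j + x) else 0),
       halted pL (run pL t s) &
       [/\ (t <= tau)%N,
          (forall x, (x < kk.+1)%N -> mem (run pL t s) (kk.+1 + x) = lab j x) &
          forall d, (q <= d)%N -> reg (run pL t s) d = 0]].
  move=> jn; exists (tf j), (init (W j) (eps / 3)).
  have [_ halts _ _] := tfP j jn; split=> //.
  - by move=> d; rewrite /= cardW.
  - move=> x /=; case: ltnP => xk; first by rewrite (@nth_window _ n).
    by rewrite nth_default // size_items cardW.
  split=> //; first exact: tf_tau.
  move=> d qd; rewrite run_reg_high //=.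
  have := leq_trans (reg_bound_ge2 pL) qd.
  by case: d {qd} => [|[|d]].
have B0' : B != 0 by rewrite gt_eqF //; lra.
have a0e : a 0%N * eps != 0 by rewrite mulf_neq0 // gt_eqF.
have /andP[_ epsL] := level_bounds eps01.
have rhi d : (2 <= d)%N -> reg (init J eps) d = 0 by case: d => [|[|d]].
have mhi i : (n <= i)%N -> mem (init J eps) i = 0.
  by move=> ni; rewrite /= nth_default // size_items.
have [t [r' [m' [tT [jb [beta [jbn betaE best outE]]] runE]]]] :=
  @wp_SSR_cmd _ n kk q eps B a lab n0 B0' labP pL tau (reg_bound_ge2 pL) simP L
    (reg (init J eps)) (mem (init J eps)) n2 (fun u => @level_small _ _ u eps01)
    epsL (erefl kk) k_tau a0e (erefl B) (erefl _) (erefl _)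
    rhi (fun i _ => erefl) mhi.
have runE0 : run (SSR_program pL) t (init J eps) =
    State (0 + clen (SSR_cmd pL q)) r' m' := runE _ 0%N (@code_at_self _).
exists t; rewrite /= runE0; split.
- apply: (@le_trans _ _ ((125 + q) * (n * tau))%N%:R); first by rewrite ler_nat.
  rewrite !natrM ler_wpM2l // ler_wpM2l //.
  by rewrite truncn_le.
- by rewrite /halted /SSR_program size_compile add0n.
- move=> i i_n /=; rewrite outE //; apply: (@out_labelP _ n) => // t' tk.
  exact: labP.
rewrite optE -EFinM.
have pos x (d : nat) : x \in output J (State (0 + clen (SSR_cmd pL q)) r' m') d -> 0 < x.
  by move=> /(fsubsetP (output_sub _ _ _)); apply: J0.
apply/ratio_leP; [by move=> x; apply: pos | by move=> x; apply: pos |].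
have outS (d : nat) : d%:R != 3 :> R ->
    Sigma (output J (State (0 + clen (SSR_cmd pL q)) r' m') d) =
    part_sum kk a lab d%:R jb.
  move=> d3; rewrite -(weight_out_label (n := n)) // (Sigma_weight (output_sub _ _ _)).
  by congr weight; apply/setP => i; rewrite !inE mem_output //= outE.
have part_ge0 d j : (j < n)%N -> 0 <= part_sum kk a lab d j.
  move=> jn; rewrite (part_sumE _ B); apply: sumr_ge0 => t' _.
  apply/ltW/(@padded_gt0 _ n) => //; have := ltn_ord t'; move: jn; clear; lia.
rewrite !outS; try by apply/eqP; lra.
have [j [A' [B' [dA' jU sup balA']]]] :=
  window_reduction a_gt0 a_lt eps01 (ltW epsL) (erefl kk.+1) dAB balAB.
have optW : (OPTL (W j) <= ((1 + eps / 4) * c)%:E)%E.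
  by apply: (@OPTL_window _ n kk B a n0 B2 a_gt0 a_lt j (ltn_ord j) A' B') => //; exists j.
have [_ _ _ ratW] := tfP j (ltn_ord j).
have := window_answer n2 a_gt0 a_lt eps01 (erefl B) c_ge1 c_le (ltn_ord j)
  (fun t _ => erefl (lab j t)) ratW optW.
move=> /score_le/andP[s1 s2].
have beta_le : beta <= (1 + eps) * c := le_trans (best j (ltn_ord j) s1) s2.
(* The value [B] would mean that no answer was accepted, but the window [j] has a score of at most
   [(1 + eps) * c <= 2 * c < B]. *)
have betaB : beta != B.
  have := base_large n2 a_gt0 eps01 (erefl B) c_ge1 c_le; rewrite -/B => BL.
  have : (1 + eps) * c <= 2 * c by rewrite ler_pM2r; lra.
  by move=> ?; apply/eqP => E; rewrite E in beta_le; lra.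
case: betaE => [E|[sjb E]]; first by rewrite E eqxx in betaB.
by apply: balanced_le (score_balanced (part_ge0 _ _ jbn) (part_ge0 _ _ jbn) sjb); rewrite -E.
Qed.

Theorem theorem3p3 (R : realType) :
  exists k : R -> nat,
    (exists c : R, forall eps : R, 0 < eps < 1 ->
       (2 <= k eps)%N /\ (k eps)%:R <= c * (1 + ln (1 / eps) ^+ 2)) /\
    forall TL : nat -> R -> R,
      (exists pL : program, solves_SSRL pL TL) ->
      exists (p : program) (C : R),
        solves_SSR p (fun n eps => C * (n%:R * TL (k eps) (eps / 3))).
Proof.
exists (@window_size R); split.
  exists 200 => eps eps01; split; last exact: window_size_bound.
  by rewrite /window_size ltnS muln_gt0 addn_gt0 orbT.
move=> TL [pL solL]; exists (SSR_program pL), (125 + reg_bound pL)%:R.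
exact: SSR_program_solves.
Qed.
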